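(* Let $b>0$, $r>0$, $x_R\in(0,b)$. Let $\mathcal X(t)$ be (undrifted) Brownian motion with Poissonian resetting at rate $r$ to the position $x_R$, starting from a random initial position $\mathcal X(0)=\eta\in(0,b)$ which is independent of $\mathcal X(t)$ (i.e. of the driving Brownian motion and of the resetting Poisson process), and let $f(t)$, $t>0$, be a given first-passage-time (FPT) density. For $\lambda>0$ set $\alpha_\lambda=\sqrt{2(\lambda+r)}$ and $$\mathcal A_\lambda=\lambda\sinh(\alpha_\lambda b)+r\sinh(\alpha_\lambda x_R)+r\sinh(\alpha_\lambda(b-x_R)).$$ If there exists a solution $g$ to the inverse first-exit time (IFET) problem for $\mathcal X(t)$ corresponding to $f$, then for all $\lambda>0$ $$\widehat f(\lambda)=1-\frac{\lambda}{\mathcal A_\lambda}\left\{\sinh(\alpha_\lambda b)-\frac12\left[\left(e^{\alpha_\lambda b}-1\right)\widehat g(\alpha_\lambda)+\left(1-e^{-\alpha_\lambda b}\right)\widehat g(-\alpha_\lambda)\right]\right\}.$$ If, in addition, $g$ is required to be symmetric with respect to $x=b/2$, that is $g\left(\frac b2-u\right)=g\left(\frac b2+u\right)$ for $u\in(0,b/2)$, then $\widehat g(\theta)=e^{-b\theta}\,\widehat g(-\theta)$ for $\theta>0$, and the identity above becomes $$\widehat f(\lambda)=1-\frac{\lambda}{\mathcal A_\lambda}\left[\sinh(\alpha_\lambda b)-\left(e^{\alpha_\lambda b}-1\right)\widehat g(\alpha_\lambda)\right],\qquad \lambda>0,$$ or, equivalently, for $\theta>\sqrt{2r}$ (where $\theta=\alpha_\lambda$,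 i.e. $\lambda=\frac{\theta^2}{2}-r>0$), $$\widehat g(\theta)=\frac{\left[\left(\frac{\theta^2}{2}-r\right)\sinh(\theta b)+r\,s\right]\widehat f\left(\frac{\theta^2}{2}-r\right)-r\,s}{\left(\frac{\theta^2}{2}-r\right)\left(e^{\theta b}-1\right)},\qquad s=\sinh(\theta x_R)+\sinh(\theta(b-x_R)).$$
   Context: Brownian motion with Poissonian resetting: let $W_t$ be a standard Brownian motion and let resetting events occur according to a homogeneous Poisson process of rate $r>0$ independent of $W$. Until the first resetting event $\mathcal X(t)=\eta+W_t$. At each resetting event $\mathcal X$ is set instantly to $x_R\in(0,b)$; after that it evolves again as a Brownian motion starting afresh from $x_R$, independently of the past, until the next resetting event, and so on. For $C^2$ functions $u$ the generator of $\mathcal X$ is $\mathcal L u(x)=\frac12u''(x)+r(u(x_R)-u(x))$. First-exit time: $\tau=\inf\{t>0:\mathcal X(t)\notin(0,b)\}$, where $\mathcal X(0)=\eta$ is random. IFET problem: given a probability density $f$ on $(0,+\infty)$ (called the FPT density) with distribution function $F$, $f=F'$, a solution to the IFET problem for $\mathcal X(t)$ corresponding to $f$ is a probability density $g$ on $(0,b)$ such that, when $\eta$ has density $g$, one has $P[\tau\le t]=F(t)$ for all $t>0$. Laplace transforms: $\widehat f(\lambda)=\int_0^\infty e^{-\lambda t}f(t)\,dt$ for $\lambda>0$, and $\widehat g(\theta)=\int_0^b e^{-\theta x}g(x)\,dx$ for $\theta\in\mathbb R$. *)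

(* Defs.v *)
From HB Require Import structures.
From mathcomp Require Import all_boot all_order all_algebra.
From mathcomp Require Import all_classical all_reals all_analysis.

Set Implicit Arguments.
Unset Strict Implicit.
Unset Printing Implicit Defensive.

Import Order.TTheory GRing.Theory Num.Theory.
Import numFieldNormedType.Exports.

Local Open Scope classical_set_scope.
Local Open Scope ring_scope.

Definition sinh {R : realType} (x : R) : R := (expR x - expR (- x)) / 2.

Definition independent_systems {d : measure_display} {Omega : measurableType d}
    {R : realType} (P : probability Omega R) {I : eqType}
    (G : I -> set (set Omega)) : Prop :=
  forall (J : seq I) (A : I -> set Omega), uniq J ->
    (forall i, i \in J -> G i (A i)) ->
    P (\bigcap_(i in [set` J]) A i) = (\prod_(i <- J) P (A i))%E.

Definition sigma_rv {d : measure_display} {Omega : measurableType d}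
    {R : realType} (X : Omega -> R) : set (set Omega) :=
  preimage_set_system setT X measurable.

Definition sigma_process {d : measure_display} {Omega : measurableType d}
    {R : realType} {I : Type} (D : set I) (X : I -> Omega -> R) :
    set (set Omega) :=
  <<s \bigcup_(i in D) sigma_rv (X i) >>.

(* Path properties are imposed at every sample point rather than almost surely,
   so that exit events are measurable without completing [P].
   The second argument of [normal_prob] is the standard deviation. *)
Definition brownian_motion {d : measure_display} {Omega : measurableType d}
    {R : realType} (P : probability Omega R) (W : R -> {RV P >-> R}) : Prop :=
  [/\ forall w, W 0 w = 0,
      forall w, {within `[0, +oo[, continuous (fun t : R => W t w)},
      forall s t : R, 0 <= s -> s < t -> forall A : set R, measurable A ->
        P ((W t \- W s) @^-1` A) =
        normal_prob 0 (Num.sqrt (t - s)) A &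
      forall u : nat -> R, 0 <= u 0%N -> nondecreasing_seq u ->
        independent_systems P (fun i => sigma_rv (W (u i.+1) \- W (u i)))].

(* The event times T 1 < T 2 < ... of a homogeneous Poisson process of rate r:
   i.i.d. exponential waiting times, counted from the origin T 0 = 0, which is
   not itself an event. *)
Definition poisson_process {d : measure_display} {Omega : measurableType d}
    {R : realType} (P : probability Omega R) (r : R)
    (T : nat -> {RV P >-> R}) : Prop :=
  [/\ forall w, T 0%N w = 0,
      forall w n, T n w < T n.+1 w,
      forall w, T n w @[n --> \oo] --> +oo,
      forall n (A : set R), measurable A ->
        P ((T n.+1 \- T n) @^-1` A) = exponential_prob r A &
      independent_systems P (fun n => sigma_rv (T n.+1 \- T n))].

(* [W n] drives the motion between the [n]-th and the [n.+1]-th event; the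
   path starts from [eta] when [n = 0] and from [xR] at every later event. *)
Definition resetting_brownian_motion {d : measure_display}
    {Omega : measurableType d} {R : realType} (P : probability Omega R)
    (r xR : R) (eta : {RV P >-> R}) (X : R -> Omega -> R) : Prop :=
  exists (T : nat -> {RV P >-> R}) (W : nat -> R -> {RV P >-> R}),
    [/\ poisson_process r T,
        forall n, brownian_motion (W n),
        independent_systems P (fun k : nat =>
          match k with
          | 0 => sigma_rv eta
          | 1 => sigma_process setT T
          | n.+2 => sigma_process `[0, +oo[ (W n)
          end) &
        forall w n t, T n w <= t < T n.+1 w ->
          X t w = (if n is 0 then eta w else xR) + W n (t - T n w) w].

Definition exit_time {R : realType} {Omega : Type} (b : R)
    (X : R -> Omega -> R) (w : Omega) : \bar R :=
  ereal_inf [set t%:E | t in [set t : R | 0 < t /\ X t w \notin `]0, b[]].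

Definition prob_density {R : realType} (D : set R) (f : R -> R) : Prop :=
  [/\ measurable_fun D f, forall x, D x -> 0 <= f x &
      (\int[lebesgue_measure]_(x in D) (f x)%:E = 1)%E].

Definition has_density {d : measure_display} {Omega : measurableType d}
    {R : realType} (P : probability Omega R) (X : {RV P >-> R}) (D : set R)
    (f : R -> R) : Prop :=
  forall A : set R, measurable A ->
    (distribution P X A = \int[lebesgue_measure]_(x in A `&` D) (f x)%:E)%E.

(* [g] solves the inverse first-exit time problem for the process [X] started
   from [eta]: [g] is the density of [eta], and [f] that of the exit time. *)
Definition ifet_solution {d : measure_display} {Omega : measurableType d}
    {R : realType} (P : probability Omega R) (b : R) (eta : {RV P >-> R})
    (X : R -> Omega -> R) (f g : R -> R) : Prop :=
  [/\ prob_density `]0, b[ g,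
      has_density eta `]0, b[ g &
      forall t : R, 0 < t ->
        (P [set w | exit_time b X w <= t%:E] =
         \int[lebesgue_measure]_(s in `]0%R, t]) (f s)%:E)%E].

Definition laplace {R : realType} (D : set R) (f : R -> R) (theta : R) : R :=
  \int[lebesgue_measure]_(x in D) (expR (- theta * x) * f x).

Definition alpha {R : realType} (r lambda : R) : R :=
  Num.sqrt (2 * (lambda + r)).

Definition calA {R : realType} (b r xR lambda : R) : R :=
  lambda * sinh (alpha r lambda * b) + r * sinh (alpha r lambda * xR)
  + r * sinh (alpha r lambda * (b - xR)).

(* Main.v *)
From HB Require Import structures.
Require Import Defs.
From mathcomp Require Import all_boot all_order all_algebra.
From mathcomp Require Import all_classical all_reals all_analysis.
From mathcomp Require Import measurable_realfun ring lra.
Import Order.TTheory GRing.Theory Num.Theory.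
Import numFieldNormedType.Exports.
Local Open Scope classical_set_scope.
Local Open Scope ring_scope.

(** Between two resetting events the process is a Brownian motion, started from
    [eta] during the first cycle and from [xR] during the later ones, and the
    length of a cycle is an independent exponential clock of rate [r].  All the
    probability lies in two facts about such a cycle.

    - A Brownian motion started from [x] leaves the interval ]0, b[ at a time
      [sigma] with E exp (- gamma sigma) = phi x, where
      phi x = cosh (a (x - b / 2)) / cosh (a b / 2) and a ^ 2 = 2 gamma
      (lemma [brownian_exit_laplace]).  Indeed the exponential martingales with
      parameters [a] and [- a] add up to
      2 exp (- gamma t) cosh (a (x - b / 2)), whose hyperbolic cosine takes the
      same value at both ends of the interval.  Optional stopping follows by
      replacing the exit time by the next point of a regular grid, where the
      martingale property is the independence of an increment from the past
      ([history_indep]), and letting the mesh tend to 0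
      ([expectation_exit_before]).
    - An independent clock of rate [r] turns the discount rate [lambda] into
      [lambda + r] ([expectation_before_clock]): with gamma = lambda + r and
      q = r / gamma, the exit before the clock is worth [phi x], and the clock
      ringing first is worth q (1 - phi x) ([expectation_clock_first]).

    Let [v] be the solution of v = phi xR + q (1 - phi xR) v.  A motion that
    restarts from [xR] is worth [v]; replacing the future after the [n]-th event
    by [v] gives an estimate of exp (- lambda tau) whose expectation is the same
    for all positive [n], because the [n]-th cycle is independent of the preceding ones,
    and whose error is at most exp (- lambda T n), which tends to 0.  Hence
    E exp (- lambda tau) = E phi eta + q (1 - E phi eta) v
    ([renewal_laplace]).

    It remains to read the two sides as Laplace transforms.  The left-hand side
    is the transform of [f] by Fubini's theorem ([expectation_discount]).  On the
    right-hand side E phi eta is a combination of the transforms of [g] at [a]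
    and [- a] ([expectation_exit_transform]), and multiplying by sinh (a b)
    clears the hyperbolic cosines.  The symmetric case follows from the change of
    variable x |-> b - x ([laplace_symmetric]) and from solving a linear
    equation. *)

Set Implicit Arguments.
Unset Strict Implicit.
Unset Printing Implicit Defensive.

(** * Independence of sigma-algebras *)

Section independence.
Context {d : measure_display} {Omega : measurableType d} {R : realType}
  (P : probability Omega R).
Implicit Types (C G H : set (set Omega)) (A B : set Omega).
Local Open Scope ereal_scope.

Definition indep2 G H := forall A B, G A -> H B -> P (A `&` B) = P A * P B.

Lemma indep2C G H : indep2 G H -> indep2 H G.
Proof. by move=> GH A B HA GB; rewrite setIC GH// muleC. Qed.

Lemma indep2_sub G H G' H' : G' `<=` G -> H' `<=` H -> indep2 G H ->
  indep2 G' H'.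
Proof. by move=> GG HH GH A B /GG ? /HH ?; exact: GH. Qed.

Lemma sigma_measurable C : C `<=` measurable -> <<s C >> `<=` measurable.
Proof.
by move=> Cm; apply: smallest_sub => //; exact: sigma_algebra_measurable.
Qed.

(** For a fixed [B] the finite measures sending [A] to P (A `&` B) and to
    P A * P B agree on the pi-system [C], hence on the sigma-algebra that it
    generates. *)
Lemma indep2_sigma_l C H : C `<=` measurable -> setI_closed C ->
  H `<=` measurable -> indep2 C H -> indep2 <<s C >> H.
Proof.
move=> Cm CI Hm CH A B CA HB; have mB : measurable B by exact: Hm.
pose k : {nonneg R} := NngNum (fine_ge0 (measure_ge0 P B)).
have kE : k%:num%:E = P B by rewrite /= fineK// fin_num_measure.
have CT : [set X | C X /\ X `<=` setT] = C.
  by apply/seteqP; split => [X []//|X CX]; split.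
have := @g_sigma_algebra_measure_unique_trace _ _ _ C setT measurableT.
rewrite CT => /(_ R Cm CI (mrestr P mB) (mscale k P)).
rewrite /= /mrestr /mscale /= -[(fine _)%:E]/(k%:num%:E) kE.
move=> h; rewrite h//.
- by rewrite muleC.
- by rewrite setTI probability_setT mule1.
- by move=> X CX /=; rewrite CH// muleC.
- by rewrite setTI (le_lt_trans (probability_le1 _ _))// ltry.
Qed.

Lemma indep2_sigma C1 C2 : C1 `<=` measurable -> setI_closed C1 ->
  C2 `<=` measurable -> setI_closed C2 -> indep2 C1 C2 ->
  indep2 <<s C1 >> <<s C2 >>.
Proof.
move=> C1m C1I C2m C2I C12; apply: indep2_sigma_l => //.
  exact: sigma_measurable.
by apply: indep2C; apply: indep2_sigma_l => //; exact: indep2C.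
Qed.

End independence.

Section grouping.
Context {d : measure_display} {Omega : measurableType d} {R : realType}
  (P : probability Omega R) {I : choiceType} (S : I -> set (set Omega)).
Hypothesis Sm : forall i, S i `<=` measurable.
Hypothesis SI : forall i, setI_closed (S i).
Hypothesis ST : forall i, S i setT.
Hypothesis Sind : independent_systems P S.

(** The pi-system on which the independence of the family is directly
    applicable. *)
Definition rectangles (J : set I) : set (set Omega) :=
  [set A | exists (s : seq I) (F : I -> set Omega), [/\ [set` s] `<=` J,
     forall i, S i (F i) & A = \bigcap_(i in [set` s]) F i]].

Let rectangles_measurable J : rectangles J `<=` measurable.
Proof.
move=> A [s [F [sJ SF ->]]]; rewrite bigcap_seq.
by apply: bigsetI_measurable => i _; exact: Sm (SF i).
Qed.

Let rectangles_setI J : setI_closed (rectangles J).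
Proof.
move=> _ _ [s1 [F1 [s1J SF1 ->]]] [s2 [F2 [s2J SF2 ->]]].
exists (s1 ++ s2), (fun i => (if i \in s1 then F1 i else setT) `&`
  (if i \in s2 then F2 i else setT)); split.
- by move=> i /=; rewrite mem_cat => /orP[/s1J|/s2J].
- by move=> i; apply: SI; case: ifPn.
- apply/seteqP; split => w.
    by move=> [w1 w2] i /= _; split; case: ifPn => //= ?; [exact: w1|exact: w2].
  by move=> h; split => i /= si; have /= := h i; rewrite mem_cat si ?orbT;
    case/(_ erefl).
Qed.

Let rectangles_indep J1 J2 : J1 `&` J2 = set0 ->
  indep2 P (rectangles J1) (rectangles J2).
Proof.
move=> J12 _ _ [s1 [F1 [s1J SF1 ->]]] [s2 [F2 [s2J SF2 ->]]].
wlog us1 : s1 s1J / uniq s1.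
  move=> /(_ (undup s1)); rewrite (_ : [set` undup s1] = [set` s1]).
    by apply => //; exact: undup_uniq.
  by apply/seteqP; split => i /=; rewrite mem_undup.
wlog us2 : s2 s2J / uniq s2.
  move=> /(_ (undup s2)); rewrite (_ : [set` undup s2] = [set` s2]).
    by apply => //; exact: undup_uniq.
  by apply/seteqP; split => i /=; rewrite mem_undup.
have s12 i : i \in s1 -> i \in s2 -> False.
  by move=> /s1J i1 /s2J i2; have : (J1 `&` J2) i by []; rewrite J12.
pose F i := if i \in s1 then F1 i else F2 i.
have -> : \bigcap_(i in [set` s1]) F1 i `&` \bigcap_(i in [set` s2]) F2 i =
    \bigcap_(i in [set` s1 ++ s2]) F i.
  apply/seteqP; split => w.
    move=> [w1 w2] i /=; rewrite mem_cat /F => /orP[i1|i2].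
      by rewrite i1; exact: w1.
    by case: ifPn => i1; [exact: w1|exact: w2].
  move=> h; split => i /= si; have /= := h i; rewrite mem_cat si ?orbT /F.
    by rewrite si; exact.
  by case: ifPn => [/s12 /(_ si)//|_]; exact.
rewrite !Sind//.
- rewrite big_cat/=; congr (_ * _)%E; rewrite big_seq_cond [RHS]big_seq_cond.
    by apply: eq_bigr => i /andP[i1 _]; rewrite /F i1.
  apply: eq_bigr => i /andP[i2 _]; rewrite /F.
  by case: ifPn => [/s12 /(_ i2)|].
- rewrite cat_uniq us1 us2 andbT/=; apply/negP => /hasP[i i2 i1].
  exact: s12 i1 i2.
- by move=> i _; rewrite /F; case: ifPn.
Qed.

(** Disjoint subfamilies of an independent family generate independent
    sigma-algebras: on rectangles this is the product rule over the union of the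
    two index sets. *)
Lemma indep2_group J1 J2 : J1 `&` J2 = set0 ->
  indep2 P <<s \bigcup_(i in J1) S i >> <<s \bigcup_(i in J2) S i >>.
Proof.
move=> J12.
have sub J : \bigcup_(i in J) S i `<=` rectangles J.
  move=> A [i Ji SA]; exists [:: i], (fun j => if j == i then A else setT).
  split.
  - by move=> j /=; rewrite inE => /eqP ->.
  - by move=> j; case: eqVneq => [->|].
  - by rewrite set_cons1 bigcap_set1 eqxx.
apply: (@indep2_sub _ _ _ P <<s rectangles J1 >> <<s rectangles J2 >>).
- exact: sub_sigma_algebra2.
- exact: sub_sigma_algebra2.
- by apply: indep2_sigma => //; exact: rectangles_indep.
Qed.

End grouping.

Section nested_independence.
Context {d : measure_display} {Omega : measurableType d} {R : realType}
  (P : probability Omega R) {I J : choiceType}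
  (G : I -> set (set Omega)) (i0 : I) (H : J -> set (set Omega)).

(** The [i0]-th member of [G] is refined into the family [H].  The index
    [i0] remains, with a trivial system, so that the index type is a plain sum. *)
Definition split_system (k : I + J) : set (set Omega) :=
  match k with
  | inl i => if i == i0 then [set setT] else G i
  | inr j => H j
  end.

Let left (k : I + J) := if k is inl i then Some i else None.
Let right (k : I + J) := if k is inr j then Some j else None.

Let perm_sum (K : seq (I + J)) :
  perm_eq K (map inl (pmap left K) ++ map inr (pmap right K)).
Proof.
elim: K => // -[i|j] K IH /=; first by rewrite perm_cons.
by rewrite perm_sym perm_catC /= perm_cons perm_catC perm_sym.
Qed.

(** An intersection over the split family is an intersection over [I] whose
    [i0]-th term is an intersection over [J]. *)
Lemma independent_split : independent_systems P G -> independent_systems P H ->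
  (forall (s : seq J) F, (forall j, j \in s -> H j (F j)) ->
    G i0 (\bigcap_(j in [set` s]) F j)) ->
  independent_systems P split_system.
Proof.
move=> Gind Hind HG K A uK KA.
set l1 := pmap left K; set l2 := pmap right K.
have pK : perm_eq K (map inl l1 ++ map inr l2) := perm_sum K.
have memK k : (k \in K) = (k \in map inl l1 ++ map inr l2) by exact: perm_mem.
have inj1 : injective (@inl I J) by move=> ? ? [].
have inj2 : injective (@inr I J) by move=> ? ? [].
have in1 i : i \in l1 -> inl i \in K.
  by move=> i1; rewrite memK mem_cat map_f.
have in2 j : j \in l2 -> inr j \in K.
  by move=> i1; rewrite memK mem_cat map_f ?orbT.
have /and3P[u1 _ u2] : [&& uniq l1, true & uniq l2].
  by move: uK; rewrite (perm_uniq pK) cat_uniq !map_inj_uniq// => /and3P[-> _ ->].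
pose s1 := [seq i <- l1 | i != i0].
pose A' i := if i == i0 then \bigcap_(j in [set` l2]) A (inr j) else A (inl i).
have Ai0 : i0 \in l1 -> A (inl i0) = setT.
  by move=> /in1 /KA /=; rewrite eqxx.
have -> : \bigcap_(k in [set` K]) A k = \bigcap_(i in [set` i0 :: s1]) A' i.
  apply/seteqP; split => w h.
    move=> i /=; rewrite inE /A'; case: eqVneq => [_ _ j /= j2|ii0 /=].
      by apply: h; exact: in2.
    by rewrite mem_filter => /andP[_ /in1]; exact: h.
  move=> k /=; rewrite memK mem_cat => /orP[] /mapP[i ii ->].
    have [ii0|ii0] := eqVneq i i0; first by rewrite ii0 Ai0// -ii0.
    have := h i; rewrite /A' (negPf ii0) /= inE mem_filter ii0 ii orbT.
    exact.
  have := h i0; rewrite /A' eqxx /= inE eqxx; exact.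
rewrite Gind; last 2 first.
- by rewrite /= filter_uniq// mem_filter eqxx.
- move=> i; rewrite inE /A'; case: eqVneq => [-> _|ii0 /=].
    by apply: HG => j /in2/KA.
  by rewrite mem_filter ii0 => /in1/KA/=; rewrite (negPf ii0).
rewrite big_cons {1}/A' eqxx Hind//; last by move=> j /in2/KA.
rewrite [RHS](perm_big _ pK)/= big_cat/= !big_map muleC; congr (_ * _)%E.
rewrite big_filter.
transitivity (\prod_(i <- l1 | i != i0) P (A (inl i)))%E.
  by apply: eq_bigr => i ii0; rewrite /A' (negPf ii0).
apply: big_rmcond_in => i i1; rewrite negbK => /eqP ii0.
by rewrite ii0 Ai0 -?ii0// probability_setT.
Qed.

End nested_independence.

(** * Expectations *)

Section expectation_of_product.
Context {d : measure_display} {Omega : measurableType d} {R : realType}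
  (P : probability Omega R).
Local Open Scope ereal_scope.

(** The law of the pair (U, V) is the product of the two laws, since they agree
    on measurable rectangles. *)
Lemma indep_integral d1 d2 (T1 : measurableType d1) (T2 : measurableType d2)
    (U : {RV P >-> T1}) (V : {RV P >-> T2}) (F : T1 * T2 -> \bar R) :
  (forall A B, measurable A -> measurable B ->
     P (U @^-1` A `&` V @^-1` B) = P (U @^-1` A) * P (V @^-1` B)) ->
  measurable_fun [set: T1 * T2] F -> (forall x, 0 <= F x) ->
  \int[P]_w F (U w, V w) =
  \int[distribution P U]_u \int[distribution P V]_v F (u, v).
Proof.
move=> UV mF F0.
have mUV : measurable_fun setT (fun w => (U w, V w)).
  by apply/measurable_fun_pair.
pose W : {RV P >-> (T1 * T2)%type} := HB.pack (fun w => (U w, V w))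
  (isMeasurableFun.Build _ _ _ _ _ mUV).
transitivity (\int[distribution P W]_z F z).
  by rewrite ge0_integral_distribution.
transitivity (\int[distribution P U \x distribution P V]_z F z).
  apply: eq_measure_integral => A mA _; apply/esym.
  exact: product_measure_unique.
by rewrite fubini_tonelli1.
Qed.

Definition adapted {d'} {T : measurableType d'} (G : set (set Omega))
  (U : Omega -> T) := forall B, measurable B -> G (U @^-1` B).

Lemma indep_expectation (G H : set (set Omega)) (U V : Omega -> R) :
  G `<=` measurable -> H `<=` measurable -> indep2 P G H ->
  adapted G U -> adapted H V ->
  (forall w, 0 <= U w)%R -> (forall w, 0 <= V w)%R ->
  \int[P]_w (U w * V w)%:E = (\int[P]_w (U w)%:E) * (\int[P]_w (V w)%:E).
Proof.
move=> Gm Hm GH GU HV U0 V0.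
have mU : measurable_fun setT U by move=> _ B mB; rewrite setTI; exact/Gm/GU.
have mV : measurable_fun setT V by move=> _ B mB; rewrite setTI; exact/Hm/HV.
pose U' : {RV P >-> R} := HB.pack U (isMeasurableFun.Build _ _ _ _ _ mU).
pose V' : {RV P >-> R} := HB.pack V (isMeasurableFun.Build _ _ _ _ _ mV).
have mN : measurable_fun setT (fun x : R => (`|x|)%:E).
  by apply/measurable_EFinP; exact: normr_measurable.
(* The absolute value makes the integrand nonnegative on the whole plane. *)
transitivity (\int[P]_w (fun x : R * R => `|x.1 * x.2|%:E) (U' w, V' w)).
  by apply: eq_integral => w _ /=; rewrite ger0_norm// mulr_ge0.
rewrite (@indep_integral _ _ R R U' V' (fun x : R * R => `|x.1 * x.2|%:E))//;
  last 2 first.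
- by move=> A B mA mB; rewrite GH//; [exact: GU|exact: HV].
- apply/measurable_EFinP; apply: measurableT_comp => //.
  by apply: measurable_funM.
under eq_integral => u _.
  under eq_integral => v _ do rewrite /= normrM EFinM.
  rewrite ge0_integralZl//.
  over.
rewrite /= ge0_integralZr//; try by apply: integral_ge0 => v _; rewrite lee_fin.
rewrite !ge0_integral_distribution//.
by congr (_ * _); apply: eq_integral => w _ /=; rewrite ger0_norm.
Qed.

End expectation_of_product.

Lemma probability_integral_cst {d : measure_display}
    {Omega : measurableType d} {R : realType} (P : probability Omega R) (c : R) :
  (\int[P]_w c%:E = c%:E)%E.
Proof. by have := expectation_cst P c; rewrite unlock. Qed.

Lemma ge0_expectationD {d : measure_display} {Omega : measurableType d}
    {R : realType} (P : probability Omega R) (f g : Omega -> R) :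
  measurable_fun setT f -> measurable_fun setT g ->
  (forall w, 0 <= f w) -> (forall w, 0 <= g w) ->
  (\int[P]_w (f w + g w)%:E = \int[P]_w (f w)%:E + \int[P]_w (g w)%:E)%E.
Proof.
move=> mf mg f0 g0; under eq_integral do rewrite EFinD.
apply: ge0_integralD => //; try by move=> w _; rewrite lee_fin.
- exact/measurable_EFinP.
- exact/measurable_EFinP.
Qed.

Lemma ge0_expectationZ {d : measure_display} {Omega : measurableType d}
    {R : realType} (P : probability Omega R) (c : R) (f : Omega -> R) :
  measurable_fun setT f -> (forall w, 0 <= f w) -> 0 <= c ->
  (\int[P]_w (c * f w)%:E = c%:E * \int[P]_w (f w)%:E)%E.
Proof.
move=> mf f0 c0; under eq_integral do rewrite EFinM.
apply: ge0_integralZl => //.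
- exact/measurable_EFinP.
- by move=> w _; rewrite lee_fin.
Qed.

(** Used for martingales stopped at approximations of a stopping time: their
    expectation is constant, and only an upper bound survives in the limit. *)
Lemma fatou_constant {d : measure_display} {Omega : measurableType d}
    {R : realType} (P : probability Omega R) (f : nat -> Omega -> R)
    (g : Omega -> R) (a : \bar R) :
  (forall n, measurable_fun setT (f n)) -> (forall n w, 0 <= f n w) ->
  (forall w, f n w @[n --> \oo] --> g w) ->
  (forall n, (\int[P]_w (f n w)%:E)%E = a) -> (\int[P]_w (g w)%:E <= a)%E.
Proof.
move=> mf f0 fg fa.
have einf (u : nat -> \bar R) l : u @ \oo --> l -> limn_einf u = l.
  by move=> ul; have [] := cvg_limn_einf_sup ul.
have := @fatou _ _ _ P setT measurableT (fun n w => (f n w)%:E).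
have mf' n : measurable_fun setT (fun w => (f n w)%:E) by exact/measurable_EFinP.
have f0' n w : setT w -> (0 <= (f n w)%:E)%E by rewrite lee_fin.
move=> /(_ mf' f0').
rewrite (_ : (fun n => \int[P]_w (f n w)%:E)%E = cst a); last exact/funext.
rewrite (einf (cst a) a); last exact: cvg_cst.
apply: le_trans; rewrite le_eqVlt; apply/orP; left; apply/eqP.
apply: eq_integral => w _; apply/esym/einf.
by apply: cvg_EFin; [exact: nearW|exact: fg].
Qed.

(** * Laws with a density *)

Section densities.
Context {R : realType}.
Local Notation leb := (@lebesgue_measure R).
Local Open Scope ereal_scope.

(** The function [p], extended by 0 outside [D], is almost everywhere the
    Radon-Nikodym derivative of [mu]. *)
Let integral_density (mu : {finite_measure set (measurableTypeR R) -> \bar R})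
    (D : set R) (p : R -> R) (h : R -> \bar R) :
  measurable D -> measurable_fun D p -> (forall x, D x -> (0 <= p x)%R) ->
  (forall A, measurable A -> mu A = \int[leb]_(x in A `&` D) (p x)%:E) ->
  measurable_fun setT h -> (forall x, 0 <= h x) ->
  \int[mu]_x h x = \int[leb]_(x in D) (h x * (p x)%:E).
Proof.
move=> mD mp p0 muE mh h0.
have mpD : measurable_fun setT (EFin \o (p \_ D)).
  by apply/measurable_EFinP; apply/(measurable_restrictT _ mD).
have muE' A : measurable A -> mu A = \int[leb]_(x in A) ((p \_ D) x)%:E.
  move=> mA; rewrite muE// integral_mkcondr; apply: eq_integral => x _.
  by rewrite /= /patch; case: ifP.
have dom : mu `<< leb.
  apply/null_content_dominatesP => A mA A0; rewrite muE'//.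
  by apply: null_set_integral => //; exact: measurable_funTS.
have fi := Radon_Nikodym_SigmaFinite.f_integrable dom.
rewrite -(Radon_Nikodym_SigmaFinite.change_of_variables dom)//.
have fp : ae_eq leb setT (Radon_Nikodym_SigmaFinite.f mu leb)
    (EFin \o (p \_ D)).
  apply: integral_ae_eq => // A _ mA.
  by rewrite -muE'// -Radon_Nikodym_SigmaFinite.f_integral.
transitivity (\int[leb]_x (h x * ((p \_ D) x)%:E)).
  apply: ae_eq_integral => //.
  - by apply: emeasurable_funM => //; exact: measurable_int fi.
  - by apply: emeasurable_funM => //.
  - by apply: ae_eqe_mul2l.
rewrite [RHS]integral_mkcond; apply: eq_integral => x _.
by rewrite /= /patch; case: ifP; rewrite ?mule0.
Qed.

Context {d : measure_display} {Omega : measurableType d}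
  (P : probability Omega R).

Lemma expectation_density (X : Omega -> R) (D : set R) (p : R -> R)
    (h : R -> \bar R) :
  measurable_fun setT X ->
  measurable D -> measurable_fun D p -> (forall x, D x -> (0 <= p x)%R) ->
  (forall A, measurable A -> P (X @^-1` A) =
     \int[leb]_(x in A `&` D) (p x)%:E) ->
  measurable_fun setT h -> (forall x, 0 <= h x) ->
  \int[P]_w h (X w) = \int[leb]_(x in D) (h x * (p x)%:E).
Proof.
move=> mX mD mp p0 XE mh h0.
have mX' : measurable_fun setT (X : Omega -> measurableTypeR R) by [].
pose X' : {mfun Omega >-> measurableTypeR R} :=
  HB.pack (X : Omega -> measurableTypeR R) (isMeasurableFun.Build _ _ _ _ _ mX').
rewrite -(@integral_density (distribution P X'))//.
by rewrite ge0_integral_distribution.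
Qed.

(** Completing the square turns the integrand into a constant times the density
    of the normal law of mean [theta * s ^+ 2]. *)
Lemma normal_mgf (X : Omega -> R) (s theta : R) : measurable_fun setT X ->
  (0 < s)%R ->
  (forall A : set R, measurable A -> P (X @^-1` A) = normal_prob 0 s A) ->
  \int[P]_w (expR (theta * X w))%:E = (expR (theta ^+ 2 * s ^+ 2 / 2))%:E.
Proof.
move=> mX s0 XE.
rewrite (@expectation_density _ setT (normal_pdf 0 s)
  (fun x => (expR (theta * x))%:E))//; last 4 first.
- exact: measurable_normal_pdf.
- by move=> x _; exact: normal_pdf_ge0.
- by move=> A mA; rewrite setIT XE.
- by apply/measurable_EFinP; apply: measurableT_comp => //;
    exact: mulrl_measurable.
transitivity (\int[leb]_x ((expR (theta ^+ 2 * s ^+ 2 / 2))%:E *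
    (normal_pdf (theta * s ^+ 2) s x)%:E)).
  apply: eq_integral => x _; rewrite -!EFinM; congr EFin.
  rewrite /normal_pdf gt_eqF//= /normal_fun mulrCA [RHS]mulrCA.
  congr (_ * _)%R; rewrite -!expRD; congr expR.
  by field; rewrite gt_eqF.
rewrite ge0_integralZl//.
- by rewrite integral_normal_pdf mule1.
- by apply/measurable_EFinP; exact: measurable_normal_pdf.
- by move=> x _; rewrite lee_fin normal_pdf_ge0.
Qed.

End densities.

(** * Discounting and exponential clocks *)

Section discount.
Context {R : realType}.
Implicit Types (gamma : R) (s : \bar R).

(** An exit time may be infinite, and is then worth nothing. *)
Definition discount gamma s : R :=
  if s is t%:E then expR (- gamma * t) else 0.

Lemma discount_ge0 gamma s : 0 <= discount gamma s.
Proof. by case: s => //= t; exact: expR_ge0. Qed.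

Lemma discount_le1 gamma s : 0 <= gamma -> (0 <= s)%E -> discount gamma s <= 1.
Proof.
move=> g0; case: s => //= t; rewrite lee_fin => t0.
by rewrite -expR0 ler_expR mulNr oppr_le0 mulr_ge0.
Qed.

Lemma measurable_discount gamma : measurable_fun setT (discount gamma).
Proof.
have -> : discount gamma =
    (fun s => expR (- gamma * fine s) * \1_[set s | s \is a fin_num] s).
  apply/funext => -[t| |] /=; rewrite indicE.
  - by rewrite mem_set ?mulr1.
  - by rewrite memNset ?mulr0.
  - by rewrite memNset ?mulr0.
apply: measurable_funM; last first.
  apply: measurable_indic; rewrite -[X in measurable X]setTI.
  exact: emeasurable_fin_num.
by apply: measurableT_comp => //; apply: measurable_funM.
Qed.

End discount.

Section exponential_clock.
Context {R : realType}.
Local Open Scope ereal_scope.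

Lemma exponential_cdf (r t : R) : (0 < t)%R ->
  exponential_prob r `]-oo, t]%classic = (1 - expR (- r * t))%:E.
Proof.
move=> t0; rewrite EFinB -exponential_prob_itv0c// /exponential_prob.
under eq_integral => x _ do rewrite -/((EFin \o exponential_pdf r) x).
rewrite [RHS](_ : _ = \int[lebesgue_measure]_(x in `]-oo, t] `&` `[0%R, +oo[)
   (exponential_pdf r x)%:E).
  rewrite integral_mkcondr; apply: eq_integral => x _.
  by rewrite /exponential_pdf /= /patch /=; case: ifP.
congr integral; apply/seteqP; split => x /=; rewrite !in_itv/= ?andbT.
  by move=> /andP[-> ->].
by move=> [-> ->].
Qed.

Context {d : measure_display} {Omega : measurableType d}
  (P : probability Omega R) (r lambda : R) (Delta : Omega -> R)
  (sigma : Omega -> \bar R).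
Hypothesis r0 : (0 < r)%R.
Hypothesis lambda0 : (0 < lambda)%R.
Hypothesis mDelta : measurable_fun setT Delta.
Hypothesis DeltaE : forall A : set R, measurable A ->
  P (Delta @^-1` A) = exponential_prob r A.
Hypothesis msigma : measurable_fun setT sigma.
Hypothesis sigma0 : forall w, 0 < sigma w.
Hypothesis sigmaDelta : forall (A : set (\bar R)) (B : set R),
  measurable A -> measurable B ->
  P (sigma @^-1` A `&` Delta @^-1` B) =
  P (sigma @^-1` A) * P (Delta @^-1` B).

Let U : {RV P >-> \bar R} := HB.pack sigma (isMeasurableFun.Build _ _ _ _ _ msigma).
Let V : {RV P >-> R} := HB.pack Delta (isMeasurableFun.Build _ _ _ _ _ mDelta).

(** Conditioning on [sigma]: the clock is integrated first, with [sigma] frozen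
    at a value [s]. *)
Let indep_clock (F : \bar R * R -> R) (f : \bar R -> R) :
  measurable_fun setT F -> (forall x, 0 <= F x)%R ->
  (forall s, 0 < s -> \int[P]_w (F (s, Delta w))%:E = (f s)%:E) ->
  \int[P]_w (F (sigma w, Delta w))%:E = \int[P]_w (f (sigma w))%:E.
Proof.
move=> mF F0 Ff.
have mEF : measurable_fun setT (EFin \o F) by exact/measurable_EFinP.
have EF0 x : 0 <= (EFin \o F) x by rewrite lee_fin.
rewrite (@indep_integral _ _ _ P _ _ _ _ U V (EFin \o F))//.
rewrite -[LHS]/(\int[distribution P U]_u fubini_F (distribution P V) (EFin \o F) u).
rewrite ge0_integral_distribution; last 2 first.
- exact: measurable_fun_fubini_tonelli_F.
- by move=> u; apply: integral_ge0 => v _; exact: EF0.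
apply: eq_integral => w _; rewrite /= /fubini_F.
rewrite (@ge0_integral_distribution _ _ _ _ _ P V
  (fun v => (EFin \o F) (sigma w, v)))//; first exact: Ff.
by apply: measurableT_comp => //; exact: measurable_fun_pair.
Qed.

(** A clock of rate [r] is still silent at time [s] with probability
    exp (- r s), which is a further discount. *)
Lemma expectation_before_clock :
  \int[P]_w (if (sigma w < (Delta w)%:E)%E then discount lambda (sigma w) else 0)%:E =
  \int[P]_w (discount (lambda + r) (sigma w))%:E.
Proof.
rewrite (@indep_clock
  (fun x => if x.1 < x.2%:E then discount lambda x.1 else 0%R)
  (discount (lambda + r)))//.
- apply: measurable_fun_ifT => //.
    apply: measurable_fun_lte => //.
    by apply/measurable_EFinP.
  by apply: measurableT_comp => //; exact: measurable_discount.
- by move=> x; case: ifP => // _; exact: discount_ge0.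
move=> [t| |]//= t0; last by rewrite integral0_eq.
rewrite lte_fin in t0.
transitivity (\int[P]_w ((expR (- lambda * t))%:E *
    (\1_(Delta @^-1` `]t, +oo[) w)%:E)).
  apply: eq_integral => w _; rewrite lte_fin -EFinM indicE; congr EFin.
  case: ifPn => tD; first by rewrite mem_set ?mulr1//= in_itv/= tD.
  by rewrite memNset ?mulr0//= in_itv/= andbT; exact/negP.
have mI : measurable (Delta @^-1` `]t, +oo[).
  by rewrite -[X in measurable X]setTI; exact: mDelta.
rewrite ge0_integralZl//; last first.
  by apply/measurable_EFinP; exact: measurable_indic.
rewrite integral_indic// setIT.
rewrite (_ : Delta @^-1` _ = ~` (Delta @^-1` `]-oo, t])); last first.
  by rewrite preimage_setC setCitvl.
transitivity ((expR (- lambda * t))%:E * (1 - P (Delta @^-1` `]-oo, t]))).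
  congr (_ * _); apply: probability_setC.
  by rewrite -[X in measurable X]setTI; exact: mDelta.
rewrite DeltaE// exponential_cdf// -EFinB subKr -EFinM -expRD.
by congr (expR _)%:E; ring.
Qed.

(** Discounting the exponential density of rate [r] at rate [lambda] gives
    r / (lambda + r) times the exponential density of rate [lambda + r]. *)
Lemma expectation_clock_first :
  \int[P]_w (if ((Delta w)%:E <= sigma w)%E then expR (- lambda * Delta w) else 0)%:E =
  \int[P]_w (r / (lambda + r) * (1 - discount (lambda + r) (sigma w)))%:E.
Proof.
rewrite (@indep_clock
  (fun x => if x.2%:E <= x.1 then expR (- lambda * x.2) else 0%R)
  (fun s => r / (lambda + r) * (1 - discount (lambda + r) s))%R)//.
- apply: measurable_fun_ifT => //.
    apply: measurable_fun_lee => //.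
    by apply/measurable_EFinP.
  by apply: measurableT_comp => //; exact: measurable_funM.
- by move=> x; case: ifP => // _; exact: expR_ge0.
move=> s s0.
have lr0 : (0 < lambda + r)%R by rewrite addr_gt0.
rewrite (@expectation_density _ _ _ P Delta setT (exponential_pdf r)
  (fun x => (if (x%:E <= s)%E then expR (- lambda * x) else 0)%:E))//; last 5 first.
- exact: measurable_exponential_pdf.
- by move=> x _; rewrite exponential_pdf_ge0// ltW.
- by move=> A mA; rewrite setIT DeltaE.
- apply/measurable_EFinP; apply: measurable_fun_ifT => //.
    by apply: measurable_fun_lee.
  by apply: measurableT_comp => //; exact: measurable_funM.
- by move=> x; rewrite lee_fin; case: ifP => // _; exact: expR_ge0.
transitivity (\int[lebesgue_measure]_(x in [set x | x%:E <= s])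
    ((r / (lambda + r))%:E * (exponential_pdf (lambda + r) x)%:E)).
  rewrite [RHS]integral_mkcond; apply: eq_integral => x _.
  rewrite /patch; case: ifPn => xs; last first.
    by rewrite mul0e memNset//=; exact/negP.
  rewrite mem_set//= -!EFinM; congr EFin.
  rewrite /exponential_pdf /patch; case: ifP => _; last by rewrite !mulr0.
  rewrite mulNr mulrCA -expRD [RHS]mulrA divfK ?gt_eqF//.
  by congr (_ * expR _)%R; ring.
rewrite ge0_integralZl//; last 4 first.
- rewrite -[X in measurable X]setTI; apply: emeasurable_fun_infty_c => //.
- by apply/measurable_EFinP/measurable_funTS; exact: measurable_exponential_pdf.
- by move=> x _; rewrite lee_fin exponential_pdf_ge0// ltW.
- by rewrite lee_fin divr_ge0// ltW.
rewrite [RHS]EFinM; congr (_ * _); case: s s0 => [t| |]//= t0.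
  rewrite (_ : [set x | x%:E <= t%:E] = `]-oo, t]%classic).
    exact: exponential_cdf.
  by apply/seteqP; split => x /=; rewrite in_itv.
rewrite subr0 (_ : [set x | x%:E <= +oo] = setT).
  exact: integral_exponential_pdf.
by apply/seteqP; split => x //= _; exact: leey.
Qed.

End exponential_clock.

(** * Exit time of a continuous path *)

Section path_exit.
Context {R : realType} (b : R) (x : R -> R).

(** The exit time [exit_time b X w] is by definition the exit time of the path
    of [w]; a single path is easier to restart and to shift. *)
Definition path_exit : \bar R :=
  ereal_inf [set t%:E | t in [set t : R | 0 < t /\ x t \notin `]0, b[]].

Hypothesis xc : {within `[0, +oo[, continuous x}.

Lemma path_continuous (t e : R) : 0 <= t -> 0 < e ->
  exists2 dl : R, 0 < dl &
    forall s : R, 0 <= s -> `|t - s| < dl -> `|x t - x s| < e.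
Proof.
move=> t0 e0; move/subspace_continuousP : xc => /(_ t).
rewrite /= in_itv/= t0 => /(_ isT) /cvgrPdist_lt /(_ _ e0).
rewrite near_withinE => /nbhs_ballP[dl /= dl0 h]; exists dl => // s s0 ts.
by apply: h => //=; rewrite in_itv/= s0.
Qed.

Hypothesis x0 : 0 < x 0 < b.

(** The converse implication needs more than safety on `[0, t]: the interval is
    open and the path continuous, so the path remains inside a little longer. *)
Lemma lt_path_exit (t : R) : 0 <= t ->
  (t%:E < path_exit)%E <-> (forall s, 0 <= s <= t -> 0 < x s < b).
Proof.
move=> t0; split => [h s /andP[s0 st]|h].
  move: s0; rewrite le_eqVlt => /predU1P[<- //|s0].
  apply: contraPT h => xs; apply/negP; rewrite -leNgt.
  apply: (@le_trans _ _ s%:E); last by rewrite lee_fin.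
  by apply: ereal_inf_lbound; exists s => //=; split => //; rewrite in_itv.
have /andP[xt xtb] : 0 < x t < b by apply: h; rewrite t0 lexx.
have [dl dl0 xdl] : exists2 dl : R, 0 < dl & forall s : R, 0 <= s -> `|t - s| < dl ->
    0 < x s < b.
  have [|dl dl0 hdl] := @path_continuous t (Num.min (x t) (b - x t)) t0.
    by rewrite lt_min xt subr_gt0.
  exists dl => // s s0 /(hdl _ s0); rewrite lt_min => /andP[].
  by rewrite !ltr_norml => /andP[h1 h2] /andP[h3 h4]; apply/andP; split; lra.
apply: (@lt_le_trans _ _ (t + dl)%:E); first by rewrite lte_fin ltrDl.
apply: le_ereal_inf_tmp => _ [s /= [s0 xs] <-]; rewrite lee_fin leNgt.
apply/negP => sdl; move: xs; apply/negP; rewrite negbK in_itv/=.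
have [st|ts] := leP s t; first by apply: h; rewrite ltW.
by apply: xdl; rewrite ?ltW// ltr_norml; apply/andP; split; lra.
Qed.

Lemma path_exit_gt0 : (0 < path_exit)%E.
Proof. by apply/lt_path_exit => // s /le_anti <-. Qed.

Lemma path_exit_boundary t : path_exit = t%:E -> x t = 0 \/ x t = b.
Proof.
move=> et; have t0 : 0 < t by rewrite -lte_fin -et path_exit_gt0.
have safe (s : R) : 0 <= s -> s < t -> 0 < x s < b.
  move=> s0 st; have : (s%:E < path_exit)%E by rewrite et lte_fin.
  by move/(lt_path_exit s0); apply; rewrite s0 lexx.
have exited : ~ (0 < x t < b).
  move=> xt; suff : (t%:E < path_exit)%E by rewrite et ltxx.
  apply/lt_path_exit; first exact: ltW.
  by move=> s /andP[s0]; rewrite le_eqVlt => /predU1P[->|]; last exact: safe.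
clear et.
have near (e : R) : 0 < e -> exists2 s : R, 0 < x s < b & `|x t - x s| < e.
  move=> e0; have [dl dl0 h] := path_continuous (ltW t0) e0.
  pose s : R := Num.max 0 (t - dl / 2).
  have [s0 st ts] : [/\ 0 <= s, s < t & `|t - s| < dl].
    rewrite /s; case: (leP 0 (t - dl / 2)) => hs; split => //;
      rewrite ?ltr_norml; try apply/andP; try split;
      lra.
  by exists s; [exact: safe|exact: h].
have xt0 : 0 <= x t.
  rewrite leNgt; apply/negP => xt; have [|s /andP[s0 sb]] := near (- x t).
    by rewrite oppr_gt0.
  by rewrite ltr_norml => /andP[]; lra.
have xtb : x t <= b.
  rewrite leNgt; apply/negP => xt; have [|s /andP[s0 sb]] := near (x t - b).
    by rewrite subr_gt0.
  by rewrite ltr_norml => /andP[]; lra.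
case: (eqVneq (x t) 0) => [->|xtn0]; first by left.
case: (eqVneq (x t) b) => [->|xtnb]; first by right.
by case: exited; rewrite !lt_neqAle xt0 xtb xtnb eq_sym xtn0.
Qed.

(** Countably many conditions at fixed times describe survival up to [t], which
    makes it an event.  By compactness a path that stays inside keeps some margin
    [j.+1%:R^-1] to the boundary; conversely a margin kept on the dense set of
    grid points extends to all times. *)
Lemma lt_path_exit_grid t : 0 <= t -> (t%:E < path_exit)%E <->
  (exists j : nat, forall m i : nat, (i <= 2 ^ m)%N ->
    j.+1%:R^-1 <= x (t * (i%:R / 2 ^+ m)) <= b - j.+1%:R^-1).
Proof.
move=> t0; rewrite (lt_path_exit t0); split => [h|[j h] s /andP[s0 st]].
- have xct : {within `[0, t], continuous x}.
    by apply: continuous_subspaceW xc => s /=; rewrite !in_itv/= andbT => /andP[].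
  have [c1 c1t c1x] := EVT_min t0 xct.
  have [c2 c2t c2x] := EVT_max t0 xct.
  have /andP[xc1 _] : 0 < x c1 < b by apply: h; rewrite in_itv in c1t.
  have /andP[_ xc2] : 0 < x c2 < b by apply: h; rewrite in_itv in c2t.
  have e0 : 0 < Num.min (x c1) (b - x c2) by rewrite lt_min xc1 subr_gt0.
  have [j hj] := ltr_add_invr e0; rewrite add0r lt_min in hj.
  have /andP[hj1 hj2] := hj.
  exists j => m i im; have ti : t * (i%:R / 2 ^+ m) \in `[0, t].
    rewrite in_itv/= mulr_ge0//= -[leRHS]mulr1 ler_wpM2l//.
    by rewrite ler_pdivrMr ?exprn_gt0// mul1r -natrX ler_nat.
  apply/andP; split; first exact: le_trans (ltW hj1) (c1x _ ti).
  move: (c2x _ ti) hj2; set y := x (t * _); set k := _^-1; lra.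
- have /andP[] : j.+1%:R^-1 <= x s <= b - j.+1%:R^-1; last first.
    have : 0 < j.+1%:R^-1 :> R by rewrite invr_gt0.
    by set k := _^-1 => k0 k1 k2; apply/andP; split; lra.
  move: s0; rewrite le_eqVlt => /predU1P[<-|s0].
    by have := h 0%N 0%N isT; rewrite mul0r mulr0.
  have t_gt0 : 0 < t by lra.
  (* The grid point just before [s], at distance less than [t / 2 ^+ m]. *)
  have near (e : R) : 0 < e -> exists m i, (i <= 2 ^ m)%N /\
      `|x s - x (t * (i%:R / 2 ^+ m))| < e.
    move=> e0; have [dl dl0 hdl] := path_continuous (ltW s0) e0.
    have [m hm] : exists m : nat, t / 2 ^+ m < dl.
      exists (Num.trunc (t / dl)).+1.
      rewrite ltr_pdivrMr ?exprn_gt0// mulrC -ltr_pdivrMr//.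
      apply: (lt_trans (truncnS_gt _)).
      by rewrite -natrX ltr_nat ltn_expl.
    pose y := s / t * 2 ^+ m; have y0 : 0 <= y.
      by rewrite mulr_ge0 ?divr_ge0 ?exprn_ge0 ?ltW.
    have m0 : 0 < 2 ^+ m :> R by rewrite exprn_gt0.
    have iy : (Num.trunc y)%:R <= y by by rewrite truncn_le.
    have yi : y < (Num.trunc y).+1%:R by exact: truncnS_gt.
    have sE : s = t / 2 ^+ m * y.
      by rewrite /y; field; rewrite !gt_eqF.
    exists m, (Num.trunc y); split.
      rewrite -(ler_nat R) natrX (le_trans iy)//.
      by rewrite /y ler_piMl ?(ltW m0)// ler_pdivrMr// mul1r.
    apply: hdl; first by rewrite mulr_ge0// divr_ge0// ltW.
    have -> : s - t * ((Num.trunc y)%:R / 2 ^+ m) =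
        t / 2 ^+ m * (y - (Num.trunc y)%:R) by rewrite {1}sE; field; rewrite gt_eqF.
    rewrite ger0_norm; last first.
      by rewrite mulr_ge0 ?subr_ge0// divr_ge0// ltW.
    apply: le_lt_trans hm; rewrite ler_piMr ?divr_ge0 ?(ltW m0)//.
    by move: yi; rewrite -natr1; lra.
  apply/andP; split; rewrite leNgt; apply/negP => xs.
    have [|m [i [/h /andP[h1 h2]]]] := near (j.+1%:R^-1 - x s).
      by rewrite subr_gt0.
    rewrite ltr_norml => /andP[]; move: h1; set k := j.+1%:R^-1; set y := x (t * _); lra.
  have [|m [i [/h /andP[h1 h2]]]] := near (x s - (b - j.+1%:R^-1)).
    by rewrite subr_gt0.
  rewrite ltr_norml => /andP[]; move: h2; set k := j.+1%:R^-1; set y := x (t * _); lra.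
Qed.

End path_exit.

(** * Exit of a Brownian motion from an interval *)

Section adapted_functions.
Context {d : measure_display} {Omega : measurableType d} {R : realType}.
Implicit Types (G : set (set Omega)).

(** Gives access to the closure properties of measurable functions. *)
Lemma adaptedP G {d'} {T : measurableType d'} (U : Omega -> T) :
  adapted <<s G >> U <->
  measurable_fun setT (U : g_sigma_algebraType G -> T).
Proof.
split => [GU _ B mB|GU B mB]; first by rewrite setTI; exact: GU.
by rewrite -[X in _ X]setTI; exact: GU.
Qed.

Lemma sub_adapted (G H : set (set Omega)) {d'} {T : measurableType d'}
  (U : Omega -> T) : G `<=` H -> adapted G U -> adapted H U.
Proof. by move=> GH GU B /GU /GH. Qed.

Lemma adapted_sigma_rv (U : Omega -> R) : adapted (sigma_rv U) U.
Proof. by move=> B mB; exists B => //; rewrite setTI. Qed.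

Lemma sigma_rv_adapted G (U : Omega -> R) : adapted G U -> sigma_rv U `<=` G.
Proof. by move=> GU _ [B mB <-]; rewrite setTI; exact: GU. Qed.

Lemma sigma_rv_sub_measurable (U : Omega -> R) : measurable_fun setT U ->
  sigma_rv U `<=` measurable.
Proof. by move=> mU _ [B mB <-]; exact: mU. Qed.

Lemma sigma_rv_setI (U : Omega -> R) : setI_closed (sigma_rv U).
Proof.
move=> _ _ [B mB <-] [B' mB' <-]; exists (B `&` B'); first exact: measurableI.
by rewrite !setTI preimage_setI.
Qed.

Lemma sigma_rv_setT (U : Omega -> R) : sigma_rv U setT.
Proof. by exists setT => //; rewrite setTI preimage_setT. Qed.

Lemma sigma_setI G : setI_closed <<s G >>.
Proof. by move=> A B GA GB; exact: (@measurableI _ (g_sigma_algebraType G)). Qed.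

Lemma sigma_setT G : <<s G >> setT.
Proof. exact: (@measurableT _ (g_sigma_algebraType G)). Qed.

Lemma sigma_bigcap_seq G {J : choiceType} (s : seq J) (F : J -> set Omega) :
  (forall j, j \in s -> <<s G >> (F j)) -> <<s G >> (\bigcap_(j in [set` s]) F j).
Proof.
move=> GF; rewrite bigcap_seq big_seq_cond.
apply: (@bigsetI_measurable _ (g_sigma_algebraType G)) => j; rewrite andbT.
exact: GF.
Qed.

Lemma independent_bool (P : probability Omega R) (G H : set (set Omega)) :
  indep2 P G H -> independent_systems P (fun c : bool => if c then G else H).
Proof.
move=> GH [|x [|y [|z J]]] A uJ JA.
- by rewrite set_nil bigcap_set0 big_nil probability_setT.
- by rewrite set_cons1 bigcap_set1 big_seq1.
- rewrite bigcap_seq !big_cons !big_nil setIT mule1.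
  have := JA x; have := JA y; rewrite !inE !eqxx !orbT => /(_ isT) Ay /(_ isT) Ax.
  case: x y uJ Ax Ay {JA} => -[] //= _ Ax Ay; first exact: GH.
  by rewrite setIC GH// muleC.
- by case: x y z uJ {JA} => -[] [] //=; rewrite ?inE ?andbF.
Qed.

End adapted_functions.

Section brownian_exit.
Context {d : measure_display} {Omega : measurableType d} {R : realType}
  (P : probability Omega R) (b : R) (xi : Omega -> R) (W : R -> {RV P >-> R}).
Hypothesis mxi : measurable_fun setT xi.
Hypothesis xi_itv : forall w, 0 < xi w < b.
Hypothesis bmW : brownian_motion W.
Hypothesis xiW : indep2 P (sigma_rv xi) (sigma_process `[0, +oo[ W).

Let X t w := xi w + W t w.
Definition brownian_exit w := path_exit b (X^~ w).
Local Notation sigma := brownian_exit.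

Let X0 w : 0 < X 0 w < b.
Proof. by case: bmW => W0 _ _ _; rewrite /X W0 addr0. Qed.

Let Xc w : {within `[0, +oo[, continuous (X^~ w)}.
Proof.
case: bmW => _ Wc _ _ t; apply: cvgD; first exact: cvg_cst.
exact: Wc.
Qed.

Section history.
Variable t : R.
Hypothesis t0 : 0 <= t.

Let grid m i : R := t * (i%:R / 2 ^+ m).

Let grid_history m : set (set Omega) :=
  sigma_rv xi `|` \bigcup_(i in [set i | (i <= 2 ^ m)%N]) sigma_rv (W (grid m i)).

(** The dyadic grids of `[0, t] are nested, so the sigma-algebras that they
    generate increase and their union is a pi-system.  Positions on a grid are
    sums of finitely many increments, to which the independence of increments
    applies. *)
Definition history : set (set Omega) :=
  [set A | exists m, <<s grid_history m >> A].

Let grid_history_homo m n : (m <= n)%N -> grid_history m `<=` grid_history n.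
Proof.
move=> mn; apply: setUS => A [i /= im iA]; exists (i * 2 ^ (n - m))%N => /=.
  by rewrite -(subnKC mn) expnD addKn leq_mul2r im orbT.
rewrite (_ : grid n _ = grid m i)//; rewrite /grid; congr (_ * _).
rewrite natrM natrX -{2}(subnKC mn) exprD invfM mulrACA.
by rewrite -[RHS]mulr1 divff// expf_neq0.
Qed.

Let mgrid_history m : grid_history m `<=` measurable.
Proof.
move=> A [|[i _]]; apply: sigma_rv_sub_measurable => //.
Qed.

Lemma history_measurable : history `<=` measurable.
Proof. by move=> A [m]; apply: sigma_measurable; exact: mgrid_history. Qed.

Lemma history_setI : setI_closed history.
Proof.
move=> A B [m mA] [n nB]; exists (maxn m n); apply: sigma_setI.
  by apply: sub_sigma_algebra2 mA; apply: grid_history_homo; exact: leq_maxl.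
by apply: sub_sigma_algebra2 nB; apply: grid_history_homo; exact: leq_maxr.
Qed.

Lemma adapted_history_start : adapted <<s history >> xi.
Proof.
move=> B mB; apply: sub_sigma_algebra; exists 0%N; apply: sub_sigma_algebra.
by left; exact: adapted_sigma_rv.
Qed.

Let adapted_history_grid m i : (i <= 2 ^ m)%N ->
  adapted <<s history >> (W (grid m i)).
Proof.
move=> im B mB; apply: sub_sigma_algebra; exists m; apply: sub_sigma_algebra.
by right; exists i => //; exact: adapted_sigma_rv.
Qed.

Lemma adapted_history_end : adapted <<s history >> (W t).
Proof.
have := @adapted_history_grid 0 1 isT.
by rewrite /grid expr0 divr1 mulr1.
Qed.

Lemma history_before_exit : <<s history >> [set w | (t%:E < sigma w)%E].
Proof.
have -> : [set w | (t%:E < sigma w)%E] = \bigcup_j \bigcap_m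
    \bigcap_(i in [set i | (i <= 2 ^ m)%N])
      (X (grid m i) @^-1` `[j.+1%:R^-1, b - j.+1%:R^-1]).
  apply/seteqP; split => w.
    move=> /(lt_path_exit_grid (@Xc w) (X0 w) t0)[j h]; exists j => // m _ i /= im.
    by rewrite in_itv/=; exact: h.
  move=> [j _ h]; apply/(lt_path_exit_grid (@Xc w) (X0 w) t0); exists j => m i im.
  by have := h m I i im; rewrite /= in_itv.
apply: (@bigcupT_measurable _ (g_sigma_algebraType history)) => j.
apply: (@bigcapT_measurable _ (g_sigma_algebraType history)) => m.
apply: (@bigcap_measurable _ (g_sigma_algebraType history)).
  by exists 0%N.
move=> i /= im.
have : adapted <<s history >> (X (grid m i)).
  apply/adaptedP; apply: measurable_funD; apply/adaptedP.
    exact: adapted_history_start.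
  exact: adapted_history_grid.
by apply.
Qed.

(** By the pi-lambda theorem it is enough to consider one dyadic grid.  Its
    points followed by [t + h] form a nondecreasing sequence of times; the start
    and the increments before [t] generate the grid positions, and form with the
    last increment an independent family. *)
Lemma history_indep h : 0 < h ->
  indep2 P <<s history >> (sigma_rv (W (t + h) \- W t)).
Proof.
move=> h0; apply: indep2_sigma_l.
- exact: history_measurable.
- exact: history_setI.
- apply: sigma_rv_sub_measurable; exact: measurable_funB.
move=> A B [m mA] mB.
(* The sequence is constant from [(2 ^ m).+1] on. *)
pose u i := if (i <= 2 ^ m)%N then grid m i else t + h.
have u0 : 0 <= u 0%N by rewrite /u /grid mul0r mulr0.
have uS : nondecreasing_seq u.
  apply/nondecreasing_seqP => i; rewrite /u; case: (leqP i.+1 (2 ^ m)) => im.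
    rewrite (ltnW im) /grid ler_wpM2l// ler_wpM2r ?invr_ge0 ?exprn_ge0//.
    by rewrite ler_nat.
  case: ifP => // im'; rewrite -[leLHS]addr0; apply: lerD; last exact: ltW.
  rewrite /grid -[leRHS]mulr1 ler_wpM2l// ler_pdivrMr ?exprn_gt0// mul1r.
  by rewrite -natrX ler_nat.
have uT : u (2 ^ m)%N = t.
  by rewrite /u leqnn /grid natrX divff ?mulr1// expf_neq0.
have uTS : u (2 ^ m).+1 = t + h by rewrite /u ltnn.
pose D i : Omega -> R := W (u i.+1) \- W (u i).
pose K := split_system (fun c : bool =>
  if c then sigma_rv xi else sigma_process `[0, +oo[ W) false
  (fun i => sigma_rv (D i)).
have ge0u i : 0 <= u i by exact: le_trans u0 (uS _ _ (leq0n i)).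
have process_D i : adapted (sigma_process `[0, +oo[ W) (D i).
  have aW j : adapted (sigma_process `[0, +oo[ W) (W (u j)).
    move=> C mC; apply: sub_sigma_algebra; exists (u j).
      by rewrite /= in_itv/= ge0u.
    exact: adapted_sigma_rv.
  apply/adaptedP; apply: measurable_funB; apply/adaptedP; exact: aW.
have Kind : independent_systems P K.
  apply: independent_split.
  - exact: independent_bool.
  - by case: bmW => _ _ _; apply.
  - move=> s F sF; apply: sigma_bigcap_seq => j /sF.
    exact: sigma_rv_adapted.
have mD i : measurable_fun setT (D i) by exact: measurable_funB.
have Km k : K k `<=` measurable.
  case: k => [[]|i] /=.
  - exact: sigma_rv_sub_measurable.
  - by move=> _ ->.
  - exact: sigma_rv_sub_measurable.
have KI k : setI_closed (K k).
  case: k => [[]|i] /=.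
  - exact: sigma_rv_setI.
  - by move=> _ _ -> ->; rewrite setIT.
  - exact: sigma_rv_setI.
have KT k : K k setT.
  by case: k => [[]|i] //=; exact: sigma_rv_setT.
pose J1 : set (bool + nat) := [set k | match k with
  inl c => True | inr i => (i < 2 ^ m)%N end].
pose J2 : set (bool + nat) := [set inr (2 ^ m)%N].
have J12 : J1 `&` J2 = set0.
  by apply/seteqP; split => // -[c|i] [] //= i2 [ii]; rewrite ii ltnn in i2.
apply: (indep2_group Km KI KT Kind J12); last first.
  apply: sub_sigma_algebra; exists (inr (2 ^ m)%N) => //=.
  by rewrite /K /= /D uT uTS.
move: A mA; apply: smallest_sub; first exact: smallest_sigma_algebra.
have aWu i : (i <= 2 ^ m)%N -> adapted <<s \bigcup_(k in J1) K k >> (W (u i)).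
  elim: i => [_|i IH im].
    rewrite (_ : (W (u 0%N) : Omega -> R) = cst 0).
      by apply/adaptedP; exact: measurable_cst.
    by apply/funext => w; rewrite /u /grid mul0r mulr0; case: bmW => ->.
  rewrite (_ : (W (u i.+1) : Omega -> R) = W (u i) \+ D i); last first.
    by apply/funext => w; rewrite /D /=; ring.
  apply/adaptedP; apply: measurable_funD; apply/adaptedP.
    by apply: IH; exact: ltnW.
  move=> C mC; apply: sub_sigma_algebra; exists (inr i) => //=.
  exact: adapted_sigma_rv.
move=> A [xiA|[i /= im]].
  by apply: sub_sigma_algebra; exists (inl true).
apply: sigma_rv_adapted; have := aWu i im.
by rewrite /u im.
Qed.

End history.

Lemma brownian_exit_gt0 w : (0 < sigma w)%E.
Proof. exact: (path_exit_gt0 (@Xc w) (X0 w)). Qed.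

Lemma adapted_brownian_exit :
  adapted <<s sigma_rv xi `|` sigma_process `[0, +oo[ W >> sigma.
Proof.
set G := _ `|` _; apply/adaptedP.
apply: (measurability _ (ErealGenOInfty.measurableE R)).
move=> /= _ [_ [a ->]] <-; rewrite setTI preimage_itvoy.
have [a0|a0] := ltP a 0.
  rewrite (_ : [set w | _] = setT); first exact: sigma_setT.
  apply/seteqP; split => w //= _; apply: lt_trans (brownian_exit_gt0 w).
  by rewrite lte_fin.
have := history_before_exit a0.
apply: smallest_sub; first exact: smallest_sigma_algebra.
move=> A [m]; apply: smallest_sub; first exact: smallest_sigma_algebra.
move=> B [xiB|[i _ WB]]; apply: sub_sigma_algebra; first by left.
right; apply: sub_sigma_algebra; exists (a * (i%:R / 2 ^+ m)) => //.
by rewrite /= in_itv/= mulr_ge0// divr_ge0// exprn_ge0.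
Qed.

Lemma measurable_brownian_exit : measurable_fun setT sigma.
Proof.
move=> _ B mB; rewrite setTI; have := adapted_brownian_exit mB.
apply: sigma_measurable => A [|].
  exact: sigma_rv_sub_measurable.
by apply: sigma_measurable => C [t _]; exact: sigma_rv_sub_measurable.
Qed.

(** Centring at [b / 2] makes the sum of the martingales for [theta] and
    [- theta] take the same value at both ends of the interval. *)
Definition exp_martingale (theta t : R) w : R :=
  expR (theta * (X t w - b / 2) - theta ^+ 2 / 2 * t).

Section martingale.
Variable theta : R.
Local Notation M := (exp_martingale theta).

Lemma measurable_exp_martingale t : measurable_fun setT (M t).
Proof.
apply: measurableT_comp => //; apply: measurable_funB => //.
apply: measurable_funM => //; apply: measurable_funB => //.
exact: measurable_funD.
Qed.

Let mbefore t : 0 <= t -> measurable_fun setT (fun w => (t%:E < sigma w)%E).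
Proof.
move=> t0; apply: measurable_fun_lte => //.
exact: measurable_brownian_exit.
Qed.

(** The factor contributed by the increment from [t] to [t + h] has mean 1, and
    is independent of what happens up to [t]. *)
Let martingale_step t h : 0 <= t -> 0 < h ->
  (\int[P]_w (if (t%:E < sigma w)%E then M (t + h) w else 0)%:E =
   \int[P]_w (if (t%:E < sigma w)%E then M t w else 0)%:E)%E.
Proof.
move=> t0 h0.
pose U w : R := if (t%:E < sigma w)%E then M t w else 0.
pose dW : Omega -> R := W (t + h) \- W t.
pose V w : R := expR (- (theta ^+ 2 / 2 * h)) * expR (theta * dW w).
have mdW : measurable_fun setT dW by exact: measurable_funB.
have aU : adapted <<s history t >> U.
  apply/adaptedP; apply: measurable_fun_ifT => //.
    apply: (@measurable_fun_bool _ _ _ _ true); rewrite setTI.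
    rewrite (_ : _ @^-1` _ = [set w | (t%:E < sigma w)%E]).
      by have H := history_before_exit t0; exact H.
    by apply/seteqP; split => w /=; rewrite ?is_true_true.
  apply: measurableT_comp => //; apply: measurable_funB => //.
  apply: measurable_funM => //; apply: measurable_funB => //.
  apply: measurable_funD; apply/adaptedP.
    exact: adapted_history_start.
  exact: adapted_history_end.
have aV : adapted (sigma_rv dW) V.
  move=> B mB; exists ((fun x => expR (- (theta ^+ 2 / 2 * h)) *
    expR (theta * x)) @^-1` B); last by rewrite setTI.
  rewrite -[X in measurable X]setTI.
  by apply: measurable_funM => //; apply: measurableT_comp => //;
    exact: measurable_funM.
transitivity (\int[P]_w (U w * V w)%:E)%E.
  apply: eq_integral => w _; rewrite /U /V; case: ifP => _; last by rewrite mul0r.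
  congr EFin; rewrite /exp_martingale -!expRD; congr expR.
  by rewrite /X /dW /=; ring.
have mhist : <<s history t >> `<=` measurable.
  by apply: sigma_measurable; exact: history_measurable.
rewrite (@indep_expectation _ _ _ P _ _ U V mhist _
  (history_indep t0 h0) aU aV); last 3 first.
- exact: sigma_rv_sub_measurable.
- by move=> w; rewrite /U; case: ifP => // _; exact: expR_ge0.
- by move=> w; rewrite mulr_ge0 ?expR_ge0.
rewrite [X in (_ * X)%E](_ : _ = 1%E) ?mule1//.
under eq_integral do rewrite /V EFinM.
rewrite ge0_integralZl//; last first.
  by apply/measurable_EFinP; apply: measurableT_comp => //; exact: measurable_funM.
rewrite (@normal_mgf _ _ _ P dW (Num.sqrt h))//.
- rewrite sqr_sqrtr ?(ltW h0)// -EFinM -expRD; congr EFin.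
  by rewrite -[RHS]expR0; congr expR; ring.
- by rewrite sqrtr_gt0.
- case: bmW => _ _ Wn _ A mA; have := Wn t (t + h) t0 _ A mA.
  by rewrite ltrDl addrAC subrr add0r; apply.
Qed.

(** The first grid point of mesh [h] that is not before the exit, cut off at
    the [k]-th one.  Unlike the first grid point at which the motion is outside
    the interval, it converges to the exit time for every path. *)
Fixpoint grid_stop h k w : R :=
  if k is k'.+1 then
    if ((h * k'%:R)%:E < sigma w)%E then h * k%:R else grid_stop h k' w
  else 0.

Let grid_stop_before h k w : 0 <= h -> ((h * k%:R)%:E < sigma w)%E ->
  grid_stop h k w = h * k%:R.
Proof.
move=> h0; case: k => [|k] /=; first by rewrite mulr0.
move=> hk; rewrite ifT//; apply: le_lt_trans hk.
by rewrite lee_fin ler_wpM2l// ler_nat.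
Qed.

Lemma measurable_grid_stop h k : 0 <= h ->
  measurable_fun setT (fun w => M (grid_stop h k w) w).
Proof.
move=> h0; elim: k => [|k IH] /=; first exact: measurable_exp_martingale.
rewrite (_ : (fun w => _) = (fun w => if ((h * k%:R)%:E < sigma w)%E
   then M (h * k.+1%:R) w else M (grid_stop h k w) w)); last first.
  by apply/funext => w; case: ifP.
apply: measurable_fun_ifT => //; first by apply: mbefore; rewrite mulr_ge0.
exact: measurable_exp_martingale.
Qed.

(** The last step is frozen by the event of an earlier exit, and is a martingale
    step on its complement. *)
Lemma expectation_grid_stop h k : 0 < h ->
  (\int[P]_w (M (grid_stop h k w) w)%:E = \int[P]_w (M 0 w)%:E)%E.
Proof.
move=> h0; elim: k => [//|k IH]; rewrite -IH.
have hk0 : 0 <= h * k%:R by rewrite mulr_ge0// ltW.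
have mB := mbefore hk0.
have split_integral (f g : Omega -> R) : measurable_fun setT f ->
    measurable_fun setT g -> (forall w, 0 <= f w) -> (forall w, 0 <= g w) ->
    (\int[P]_w (if ((h * k%:R)%:E < sigma w)%E then f w else g w)%:E =
     \int[P]_w (if ((h * k%:R)%:E < sigma w)%E then f w else 0)%:E +
     \int[P]_w (if ((h * k%:R)%:E < sigma w)%E then 0 else g w)%:E)%E.
  move=> mf mg f0 g0; rewrite -ge0_expectationD.
  - by apply: eq_integral => w _; case: ifP; rewrite ?addr0 ?add0r.
  - exact: measurable_fun_ifT.
  - exact: measurable_fun_ifT.
  - by move=> w; case: ifP.
  - by move=> w; case: ifP.
have M0 t w : 0 <= M t w by exact: expR_ge0.
have mg := measurable_grid_stop k (ltW h0).
have mM := measurable_exp_martingale.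
have g0 w : 0 <= M (grid_stop h k w) w by exact: expR_ge0.
transitivity (\int[P]_w (if ((h * k%:R)%:E < sigma w)%E then M (h * k.+1%:R) w
    else M (grid_stop h k w) w)%:E)%E.
  by apply: eq_integral => w _ /=; case: ifP.
rewrite (split_integral _ _ (mM (h * k.+1%:R)) mg (M0 _) g0).
transitivity (\int[P]_w (if ((h * k%:R)%:E < sigma w)%E then M (h * k%:R) w
    else M (grid_stop h k w) w)%:E)%E; last first.
  apply: eq_integral => w _ /=; case: ifP => // hk.
  by rewrite grid_stop_before// ltW.
rewrite (split_integral _ _ (mM (h * k%:R)) mg (M0 _) g0); congr (_ + _)%E.
rewrite -(martingale_step hk0 h0).
by apply: eq_integral => w _; rewrite -natr1 mulrDr mulr1.
Qed.

(** The minimum of the exit time and [T]. *)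
Definition exit_before T w : R :=
  if (T%:E <= sigma w)%E then T else fine (sigma w).

Lemma exit_before_itv T w : 0 <= T -> 0 <= exit_before T w <= T.
Proof.
move=> T0; rewrite /exit_before; have := brownian_exit_gt0 w.
case: (sigma w) => [s| |] //=; last by rewrite leey T0 lexx.
rewrite lte_fin lee_fin => s0; case: (leP T s) => [_|sT]; first by rewrite T0 lexx.
by rewrite !ltW.
Qed.

Lemma grid_stop_itv h k w : 0 < h ->
  [/\ 0 <= grid_stop h k w, grid_stop h k w <= h * k%:R,
     exit_before (h * k%:R) w <= grid_stop h k w &
     grid_stop h k w <= exit_before (h * k%:R) w + h].
Proof.
move=> h0; elim: k => [|k [g0 gk eg ge]] /=.
  rewrite mulr0; have /andP[e1 e2] := exit_before_itv w (lexx 0).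
  by split => //; rewrite addr_ge0// ltW.
move: g0 gk eg ge; rewrite /exit_before; have := brownian_exit_gt0 w.
have k0 : 0 <= h * k%:R by rewrite mulr_ge0// ltW.
case: (sigma w) => [s| |] //=; last first.
  by rewrite !leey !ltry -natr1 mulrDr mulr1 => _ _ _ _ _; split => //; lra.
rewrite lte_fin !lee_fin lte_fin -natr1 mulrDr mulr1 => s0 g0 gk.
case: (leP (h * k%:R) s) => ks; case: (leP (h * k%:R + h) s) => ks1;
  case: (ltP (h * k%:R) s) => ks2 /= eg ge; split; move: h0 k0 s0 g0 gk eg ge ks ks1 ks2; lra.
Qed.

Lemma cvg_grid_stop T w : 0 < T ->
  M (grid_stop (T / n.+1%:R) n.+1 w) w @[n --> \oo] --> M (exit_before T w) w.
Proof.
move=> T0; set g := fun n => grid_stop (T / n.+1%:R) n.+1 w.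
set s := exit_before T w.
have gE n : [/\ 0 <= g n, s <= g n & g n <= s + T / n.+1%:R].
  have h0 : 0 < T / n.+1%:R by rewrite divr_gt0.
  have := @grid_stop_itv (T / n.+1%:R) n.+1 w h0.
  by rewrite divfK// => -[].
have s0 : 0 <= s by case/andP: (exit_before_itv w (ltW T0)).
have gs : g n @[n --> \oo] --> s.
  apply: (@squeeze_cvgr _ _ _ _ (cst s) (fun n => s + T / n.+1%:R)).
  - by apply: nearW => n; case: (gE n) => _ -> ->.
  - exact: cvg_cst.
  - rewrite -[X in _ --> X]addr0; apply: cvgD; first exact: cvg_cst.
    rewrite -[X in _ --> X](mulr0 T); apply: cvgM; first exact: cvg_cst.
    exact: cvg_harmonic.
have Xgs : X (g n) w @[n --> \oo] --> X s w.
  apply/cvgrPdist_lt => e e0.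
  have [dl dl0 h] := path_continuous (@Xc w) s0 e0.
  move/cvgrPdist_lt : gs => /(_ _ dl0); apply: filterS => n; apply: h.
  by case: (gE n).
rewrite /M; apply: continuous_cvg; first exact: continuous_expR.
apply: cvgB; last by apply: cvgM => //; exact: cvg_cst.
apply: cvgM; first exact: cvg_cst.
by apply: cvgB => //; exact: cvg_cst.
Qed.

Lemma measurable_exit_before T : 0 < T -> measurable_fun setT (fun w => M (exit_before T w) w).
Proof.
move=> T0; apply: (@measurable_fun_cvg _ _ _ _
  (fun n w => M (grid_stop (T / n.+1%:R) n.+1 w) w)).
  by move=> n; apply: measurable_grid_stop; rewrite divr_ge0// ltW.
by move=> w _; exact: cvg_grid_stop.
Qed.

Lemma expectation_exit_before_le T : 0 < T ->
  (\int[P]_w (M (exit_before T w) w)%:E <= \int[P]_w (M 0 w)%:E)%E.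
Proof.
move=> T0; apply: (@fatou_constant _ _ _ P
  (fun n w => M (grid_stop (T / n.+1%:R) n.+1 w) w)).
- by move=> n; apply: measurable_grid_stop; rewrite divr_ge0// ltW.
- by move=> n w; exact: expR_ge0.
- by move=> w; exact: cvg_grid_stop.
- by move=> n; rewrite expectation_grid_stop// divr_gt0.
Qed.

End martingale.

Local Notation M := exp_martingale.

Let M0_fin theta : (\int[P]_w (M theta 0 w)%:E)%E \is a fin_num.
Proof.
rewrite ge0_fin_numE; last by apply: integral_ge0 => w _; rewrite lee_fin expR_ge0.
apply: (@le_lt_trans _ _ (\int[P]_w (expR (`|theta| * b))%:E)%E).
  apply: ge0_le_integral => //.
  - by move=> w _; rewrite lee_fin expR_ge0.
  - by apply/measurable_EFinP; exact: measurable_exp_martingale.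
  - move=> w _; rewrite lee_fin ler_expR mulr0 subr0.
    apply: le_trans (ler_norm _) _; rewrite normrM ler_wpM2l//.
    have /andP[x1 x2] := X0 w.
    by rewrite ler_norml; apply/andP; split; lra.
by rewrite probability_integral_cst ltry.
Qed.

(** Up to time [T] the square of the martingale for [theta] is at most
    exp (theta ^ 2 T) times the martingale for [2 * theta]; the bound is then
    p <= 1 / (4 d) + d p ^ 2. *)
Let dominated theta (e T t : R) w : 0 < e -> 0 <= t <= T ->
  M theta t w <= expR (theta ^+ 2 * T) / (4 * e) + e * M (2 * theta) t w.
Proof.
move=> e0 /andP[t0 tT]; set p := M theta t w.
have -> : M (2 * theta) t w = expR (- (theta ^+ 2 * t)) * p ^+ 2.
  rewrite /p /exp_martingale -expRM_natl -expRD; congr expR.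
  by field.
set q := expR (- (theta ^+ 2 * t)).
have q0 : 0 < q by exact: expR_gt0.
have qT : q^-1 <= expR (theta ^+ 2 * T).
  by rewrite -expRN opprK ler_expR ler_wpM2l// sqr_ge0.
apply: (@le_trans _ _ (q^-1 / (4 * e) + e * (q * p ^+ 2))); last first.
  rewrite lerD2r ler_wpM2r// invr_ge0 mulr_ge0// ltW//.
rewrite -subr_ge0.
have -> : q^-1 / (4 * e) + e * (q * p ^+ 2) - p = e * q * (p - (2 * e * q)^-1) ^+ 2.
  by field; rewrite !gt_eqF.
by rewrite mulr_ge0// ?sqr_ge0// mulr_ge0// ltW.
Qed.

(** Optional stopping at the bounded time [exit_before T].  Fatou's lemma gives
    one inequality.  Applied to C + e * M (2 * theta) - M theta, which is
    nonnegative by [dominated], it gives the other one up to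
    e * E (M (2 * theta) 0), and [e] is arbitrary. *)
Lemma expectation_exit_before theta T : 0 < T ->
  (\int[P]_w (M theta (exit_before T w) w)%:E = \int[P]_w (M theta 0 w)%:E)%E.
Proof.
move=> T0; apply/eqP; rewrite eq_le expectation_exit_before_le//=.
set a := (\int[P]_w (M theta 0 w)%:E)%E; set m := (\int[P]_w _)%E.
set a' := (\int[P]_w (M (2 * theta) 0 w)%:E)%E.
have a_fin : a \is a fin_num by exact: M0_fin.
have a'_fin : a' \is a fin_num by exact: M0_fin.
have m_ge0 : (0 <= m)%E.
  by apply: integral_ge0 => w _; rewrite lee_fin expR_ge0.
have m_fin : m \is a fin_num.
  rewrite ge0_fin_numE//; apply: le_lt_trans (expectation_exit_before_le _ T0) _.
  by rewrite ltey_eq a_fin.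
have M0 th t w : 0 <= M th t w by exact: expR_ge0.
suff key (e : R) : 0 < e -> (a <= m + (e * fine a')%:E)%E.
  apply/lee_addgt0Pr => e e0.
  have a'0 : 0 <= fine a' by apply: fine_ge0; apply: integral_ge0 => w _; rewrite lee_fin.
  have := key (e / (fine a' + 1)); rewrite divr_gt0 ?ltr_wpDl// => /(_ isT) h.
  apply: (le_trans h); rewrite leeD2l// lee_fin mulrAC ler_pdivrMr ?ltr_wpDl//.
  by rewrite ler_wpM2l ?(ltW e0)// lerDl.
move=> e0; pose C := expR (theta ^+ 2 * T) / (4 * e).
have C0 : 0 <= C by rewrite divr_ge0 ?expR_ge0// mulr_ge0// ltW.
pose D t w := C + e * M (2 * theta) t w - M theta t w.
have mD g : measurable_fun setT (fun w => M theta (g w) w) ->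
  measurable_fun setT (fun w => M (2 * theta) (g w) w) ->
  measurable_fun setT (fun w => D (g w) w).
  move=> m1 m2; apply: measurable_funB => //; apply: measurable_funD => //.
  exact: measurable_funM.
have split_D g : measurable_fun setT (fun w => M theta (g w) w) ->
  measurable_fun setT (fun w => M (2 * theta) (g w) w) ->
  (forall w, 0 <= g w <= T) ->
  (\int[P]_w (M theta (g w) w)%:E + \int[P]_w (D (g w) w)%:E =
   C%:E + e%:E * \int[P]_w (M (2 * theta) (g w) w)%:E)%E.
  move=> m1 m2 gT.
  have m2' : measurable_fun setT (fun w => e * M (2 * theta) (g w) w).
    exact: measurable_funM.
  have D_ge0 w : 0 <= D (g w) w by rewrite subr_ge0; exact: dominated.
  have eM w : 0 <= e * M (2 * theta) (g w) w by rewrite mulr_ge0// ltW.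
  rewrite -(ge0_expectationD P m1 (mD _ m1 m2) (fun=> M0 _ _ _) D_ge0).
  rewrite -(ge0_expectationZ P m2 (fun=> M0 _ _ _) (ltW e0)).
  rewrite -[C%:E](probability_integral_cst P).
  rewrite -(ge0_expectationD P (measurable_cst C) m2' (fun=> C0) eM).
  by apply: eq_integral => w _; rewrite /D /=; congr EFin; ring.
have m1 th n : measurable_fun setT (fun w => M th (grid_stop (T / n.+1%:R) n.+1 w) w).
  by apply: measurable_grid_stop; rewrite divr_ge0// ltW.
have m2 th : measurable_fun setT (fun w => M th (exit_before T w) w).
  exact: measurable_exit_before.
have h0 n : 0 < T / n.+1%:R by rewrite divr_gt0.
have gT n w : 0 <= grid_stop (T / n.+1%:R) n.+1 w <= T.
  by have [-> + _ _] := @grid_stop_itv (T / n.+1%:R) n.+1 w (h0 n); rewrite divfK.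
have eT w : 0 <= exit_before T w <= T by apply: exit_before_itv; exact: ltW.
pose rho := (C%:E + e%:E * a' - a)%E.
have rhoD : (\int[P]_w (D (exit_before T w) w)%:E <= rho)%E.
  apply: (@fatou_constant _ _ _ P
    (fun n w => D (grid_stop (T / n.+1%:R) n.+1 w) w)).
  - by move=> n; apply: mD.
  - by move=> n w; rewrite subr_ge0; exact: dominated.
  - move=> w; apply: cvgB; last exact: cvg_grid_stop.
    apply: cvgD; first exact: cvg_cst.
    by apply: cvgM; [exact: cvg_cst|exact: cvg_grid_stop].
  - move=> n; have := split_D _ (m1 theta n) (m1 (2 * theta) n) (gT n).
    rewrite (expectation_grid_stop theta n.+1 (h0 n)).
    rewrite (expectation_grid_stop (2 * theta) n.+1 (h0 n)) -/a -/a' /rho => <-.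
    by rewrite addeAC subee// add0e.
have := split_D _ (m2 theta) (m2 (2 * theta)) eT; rewrite -/m => splitT.
have : (C%:E <= m + rho)%E.
  apply: (@le_trans _ _ (m + \int[P]_w (D (exit_before T w) w)%:E)%E).
    rewrite splitT leeDl// mule_ge0 ?lee_fin ?(ltW e0)//.
    by apply: integral_ge0 => w _; rewrite lee_fin.
  by rewrite leeD2l.
rewrite /rho -(fineK a_fin) -(fineK a'_fin) -(fineK m_fin) -EFinM -!EFinD.
by rewrite !lee_fin; lra.
Qed.

(** Before its exit the motion lies between 0 and [b], so the sum of the two
    martingales stopped at a large time [n.+1%:R] differs from its value [D] at
    the exit by at most the discount at that time, up to a constant factor. *)
Lemma brownian_exit_laplace theta : theta != 0 ->
  (\int[P]_w (discount (theta ^+ 2 / 2) (sigma w) *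
      (expR (theta * (b / 2)) + expR (- (theta * (b / 2)))))%:E =
   \int[P]_w (expR (theta * (xi w - b / 2)) +
      expR (- (theta * (xi w - b / 2))))%:E)%E.
Proof.
move=> th0; set K := _ + _.
pose N t w := M theta t w + M (- theta) t w.
pose D w := discount (theta ^+ 2 / 2) (sigma w) * K.
pose q (n : nat) : R := expR (- (theta ^+ 2 / 2) * n.+1%:R) * (2 * expR (`|theta| * b)).
have K0 : 0 <= K by rewrite addr_ge0 ?expR_ge0.
have th20 : 0 < theta ^+ 2 / 2 by rewrite divr_gt0// exprn_even_gt0.
have mM th n : measurable_fun setT (fun w => M th (exit_before n.+1%:R w) w).
  by exact: (measurable_exit_before).
have mN n : measurable_fun setT (fun w => N (exit_before n.+1%:R w) w).
  by apply: measurable_funD.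
have mD : measurable_fun setT D.
  apply: measurable_funM => //; apply: measurableT_comp => //.
    exact: measurable_discount.
  exact: (measurable_brownian_exit).
have N0 t w : 0 <= N t w by rewrite addr_ge0// expR_ge0.
have D0 w : 0 <= D w by rewrite mulr_ge0// discount_ge0.
have q0 n : 0 <= q n by rewrite !mulr_ge0// expR_ge0.
have NE n : (\int[P]_w (N (exit_before n.+1%:R w) w)%:E =
    \int[P]_w (expR (theta * (xi w - b / 2)) +
      expR (- (theta * (xi w - b / 2))))%:E)%E.
  have -> : (\int[P]_w (expR (theta * (xi w - b / 2)) +
      expR (- (theta * (xi w - b / 2))))%:E = \int[P]_w (N 0 w)%:E)%E.
    apply: eq_integral => w _; rewrite /N /exp_martingale /X.
    by case: bmW => -> _ _ _; rewrite !mulr0 !subr0 !addr0 mulNr.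
  have M_ge0 th t w : 0 <= M th t w by exact: expR_ge0.
  have n0 : 0 < n.+1%:R :> R by [].
  rewrite (ge0_expectationD P (mM theta n) (mM (- theta) n)
    (fun=> M_ge0 _ _ _) (fun=> M_ge0 _ _ _)).
  rewrite (expectation_exit_before theta n0)
    (expectation_exit_before (- theta) n0).
  by rewrite -(ge0_expectationD P (measurable_exp_martingale theta 0)
    (measurable_exp_martingale (- theta) 0) (fun=> M_ge0 _ _ _) (fun=> M_ge0 _ _ _)).
have bound th t w : 0 <= t -> 0 <= X t w <= b ->
    M th t w <= expR (- (th ^+ 2 / 2) * t) * expR (`|th| * b).
  move=> t0 /andP[x0 xb]; rewrite -expRD ler_expR addrC mulNr lerD2l.
  apply: le_trans (ler_norm _) _; rewrite normrM ler_wpM2l//.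
  by rewrite -/(X t w) ler_norml; apply/andP; split; lra.
have close n w : `|N (exit_before n.+1%:R w) w - D w| <= q n.
  have n0 : 0 <= n.+1%:R :> R by [].
  have boundN t : n.+1%:R <= t -> 0 <= X t w <= b -> N t w <= q n.
    move=> nt xt; have t0 : 0 <= t by exact: le_trans nt.
    rewrite /N /q mulr_natl mulr2n mulrDr.
    have nt' : expR (- (theta ^+ 2 / 2) * t) <= expR (- (theta ^+ 2 / 2) * n.+1%:R).
      by rewrite ler_expR !mulNr lerN2 ler_wpM2l// ltW.
    apply: lerD.
      apply: le_trans (bound _ _ _ t0 xt) _.
      by rewrite ler_wpM2r// expR_ge0.
    apply: le_trans (bound _ _ _ t0 xt) _.
    by rewrite sqrrN normrN ler_wpM2r// expR_ge0.
  have inside (s : R) : 0 <= s -> (s%:E < sigma w)%E -> 0 <= X s w <= b.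
    move=> s0 /(lt_path_exit (@Xc w) (X0 w) s0) /(_ s); rewrite s0 lexx.
    by move=> /(_ isT) /andP[? ?]; rewrite !ltW.
  (* At both ends of the interval the two exponentials are the same, exchanged. *)
  have atexit s : sigma w = s%:E -> N s w = D w.
    move=> es; rewrite /N /D es /= /exp_martingale /K.
    rewrite sqrrN [RHS]mulrDr -!expRD -/(X s w).
    case: (path_exit_boundary (@Xc w) (X0 w) es) => ->.
      by rewrite addrC; congr (expR _ + expR _); field.
    by congr (expR _ + expR _); field.
  rewrite /exit_before; case: ifPn => nsig; last first.
    have : (sigma w < n.+1%:R%:E)%E by rewrite ltNge.
    have := brownian_exit_gt0 w; have := atexit.
    case: (sigma w) => [s| |] //= /(_ _ erefl) -> _ _.
    by rewrite subrr normr0.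
  suff [Nq Dq] : N n.+1%:R w <= q n /\ D w <= q n.
    have := N0 n.+1%:R w; have := D0 w => ? ?.
    by rewrite ler_norml; apply/andP; split; lra.
  have [nsig'|] := ltP n.+1%:R%:E (sigma w).
    split; first by apply: boundN => //; exact: inside.
    have := atexit; rewrite /D; case es : (sigma w) => [s| |] /=.
    - move=> /(_ _ erefl) <-; apply: boundN.
        by rewrite -lee_fin -es ltW.
      have : 0 <= X s w <= b.
        by case: (path_exit_boundary (@Xc w) (X0 w) es) => ->; rewrite lexx ltW//
          (lt_trans (andP (X0 w)).1 (andP (X0 w)).2).
      by [].
    - by rewrite mul0r.
    - by rewrite mul0r.
  move=> sn; have es : sigma w = n.+1%:R%:E by apply/eqP; rewrite eq_le sn.
  rewrite -(atexit _ es); suff : N n.+1%:R w <= q n by [].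
  apply: boundN => //.
  by case: (path_exit_boundary (@Xc w) (X0 w) es) => ->; rewrite lexx ltW//
    (lt_trans (andP (X0 w)).1 (andP (X0 w)).2).
have small e : 0 < e -> exists n, q n <= e.
  move=> e0; rewrite /q; set c := theta ^+ 2 / 2; set B := 2 * _.
  have B0 : 0 < B by rewrite mulr_gt0// expR_gt0.
  exists (Num.trunc (B / (e * c))).
  set m := _.+1; have mB : B / (e * c) < m%:R by exact: truncnS_gt.
  have ec0 : 0 < e * c by exact: mulr_gt0.
  rewrite (ltr_pdivrMr _ _ ec0) in mB.
  rewrite mulNr expRN mulrC ler_pdivrMr ?expR_gt0//.
  have : e * (1 + c * m%:R) <= e * expR (c * m%:R).
    by rewrite ler_pM2l// expR_ge1Dx.
  apply: le_trans; apply: (le_trans (ltW mB)).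
  by rewrite mulrDr mulr1 mulrCA (mulrC _ c) lerDr ltW.
have leq_int (f g : Omega -> R) (c0 : R) : measurable_fun setT f -> measurable_fun setT g ->
    (forall w, 0 <= f w) -> (forall w, 0 <= g w) -> 0 <= c0 ->
    (forall w, f w <= g w + c0) ->
    (\int[P]_w (f w)%:E <= \int[P]_w (g w)%:E + c0%:E)%E.
  move=> mf mg f0 g0 c0_ge0 fg; rewrite -[c0%:E](probability_integral_cst P).
  rewrite -(ge0_expectationD P mg (measurable_cst c0) g0 (fun=> c0_ge0)).
  apply: ge0_le_integral => //.
  - by move=> w _; rewrite lee_fin.
  - exact/measurable_EFinP.
  - by apply/measurable_EFinP; exact: measurable_funD.
  - by move=> w _; rewrite lee_fin.
apply/eqP; rewrite eq_le; apply/andP; split.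
  apply/lee_addgt0Pr => e /small[n qe].
  rewrite -(NE n).
  apply: (@le_trans _ _
    (\int[P]_w (N (exit_before n.+1%:R w) w)%:E + (q n)%:E)%E).
    apply: leq_int => // w; have := close n w; rewrite ler_norml -/(D w) => /andP[]; lra.
  by rewrite leeD2l.
apply/lee_addgt0Pr => e /small[n qe].
rewrite -(NE n); apply: (@le_trans _ _ (\int[P]_w (D w)%:E + (q n)%:E)%E).
  apply: leq_int => // w; have := close n w; rewrite ler_norml -/(D w) => /andP[]; lra.
by rewrite leeD2l.
Qed.

End brownian_exit.

(** * The resetting motion *)

Section path_reset.
Context {R : realType} (b : R) (x y z : R -> R) (Delta : R).
Hypothesis yc : {within `[0, +oo[, continuous y}.
Hypothesis y0 : 0 < y 0 < b.
Hypothesis z0 : 0 < z 0 < b.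
Hypothesis Delta0 : 0 < Delta.
Hypothesis xy : forall t, 0 <= t < Delta -> x t = y t.
Hypothesis xz : forall t, 0 <= t -> x (Delta + t) = z t.

Let xE t : 0 < t -> t < Delta -> (t%:E < path_exit b y)%E -> 0 < x t < b.
Proof.
move=> t0 tD /(lt_path_exit yc y0 (ltW t0)) /(_ t).
by rewrite (ltW t0) lexx xy ?(ltW t0)//; exact.
Qed.

Let path_exit_reset_before : (path_exit b y < Delta%:E)%E ->
  path_exit b x = path_exit b y.
Proof.
have := path_exit_gt0 yc y0; case ey : (path_exit b y) => [s| |] //=.
rewrite !lte_fin => s0 sD; apply/eqP; rewrite eq_le; apply/andP; split.
  apply: ereal_inf_lbound; exists s => //=; split => //.
  rewrite xy ?(ltW s0)// in_itv/=; case: (path_exit_boundary yc y0 ey) => ->;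
    by rewrite ltxx ?andbF.
apply: le_ereal_inf_tmp => _ [t /= [t0 xt] <-]; rewrite leNgt; apply/negP => ts.
move: xt; rewrite in_itv/= xE//; last by rewrite ey.
by rewrite lte_fin in ts; exact: lt_trans sD.
Qed.

Let path_exit_reset_after : (Delta%:E <= path_exit b y)%E ->
  path_exit b x = (Delta%:E + path_exit b z)%E.
Proof.
move=> Dy; apply/eqP; rewrite eq_le; apply/andP; split.
  rewrite addeC -leeBlDr//; apply: le_ereal_inf_tmp => _ [t [t0 zt] <-].
  rewrite leeBlDr// -EFinD; apply: ereal_inf_lbound; exists (t + Delta) => //=.
  by split; [exact: addr_gt0|rewrite addrC xz// ltW].
apply: le_ereal_inf_tmp => _ [t /= [t0 xt] <-].
have [tD|Dt] := ltP t Delta.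
  by move: xt; rewrite in_itv/= xE// (lt_le_trans _ Dy)// lte_fin.
have [tD|tD] := eqVneq t Delta.
  by move: xt; rewrite tD -(addr0 Delta) xz// in_itv/= z0.
rewrite addeC -leeBrDr// -EFinB; apply: ereal_inf_lbound.
exists (t - Delta) => //=; split; first by rewrite subr_gt0 lt_neqAle eq_sym tD.
by rewrite -xz ?subr_ge0// addrC subrK.
Qed.

Lemma path_exit_reset_gt0 : (0 < path_exit b x)%E.
Proof.
have [h|h] := ltP (path_exit b y) Delta%:E.
  by rewrite path_exit_reset_before// path_exit_gt0.
rewrite path_exit_reset_after//; apply: (@lt_le_trans _ _ Delta%:E) => //.
by rewrite leeDl//; apply: le_ereal_inf_tmp => _ [t [t0 _] <-]; rewrite lee_fin ltW.
Qed.

(** The path [x] follows [y] during a cycle of length [Delta] and is [z]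
    afterwards.  If [y] has not left the interval by time [Delta], the exit of
    [x] is that of [z], delayed by [Delta]; the point [x Delta = z 0] is inside,
    so that reaching the boundary exactly at time [Delta] is no exit. *)
Lemma discount_path_exit_reset lambda : discount lambda (path_exit b x) =
  (if (path_exit b y < Delta%:E)%E then discount lambda (path_exit b y) else 0) +
  (if (Delta%:E <= path_exit b y)%E then expR (- lambda * Delta) else 0) *
    discount lambda (path_exit b z).
Proof.
case: ltP => [h|h]; first by rewrite path_exit_reset_before// mul0r addr0.
rewrite path_exit_reset_after// add0r.
by case: (path_exit b z) => [s| |] /=; rewrite ?mulr0// -expRD -mulrDr.
Qed.

End path_reset.

Section renewal.
Context {d : measure_display} {Omega : measurableType d} {R : realType}
  (P : probability Omega R) (b r xR lambda : R) (eta : {RV P >-> R})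
  (T : nat -> {RV P >-> R}) (W : nat -> R -> {RV P >-> R}) (X : R -> Omega -> R).
Hypothesis r0 : 0 < r.
Hypothesis lambda0 : 0 < lambda.
Hypothesis xR_itv : 0 < xR < b.
Hypothesis eta_itv : forall w, 0 < eta w < b.
Hypothesis poissonT : poisson_process r T.
Hypothesis bmW : forall n, brownian_motion (W n).

Let G (k : nat) : set (set Omega) := match k with
  | 0 => sigma_rv eta
  | 1 => sigma_process setT T
  | n.+2 => sigma_process `[0, +oo[ (W n)
  end.
Hypothesis indG : independent_systems P G.
Hypothesis XE : forall w n t, T n w <= t < T n.+1 w ->
  X t w = (if n is 0 then eta w else xR) + W n (t - T n w) w.

Let xi (n : nat) w : R := if n is 0 then eta w else xR.
Let Delta (n : nat) : Omega -> R := T n.+1 \- T n.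
Let sigma n : Omega -> \bar R := brownian_exit b (xi n) (W n).

Let mxi n : measurable_fun setT (xi n).
Proof. by case: n => [|n]; [exact: measurable_funPT|exact: (measurable_cst xR)]. Qed.

Let xi_itv n w : 0 < xi n w < b.
Proof. by case: n => [|n]; [exact: eta_itv|exact: xR_itv]. Qed.

Let mDelta n : measurable_fun setT (Delta n).
Proof. exact: measurable_funB. Qed.

Let Delta_gt0 n w : 0 < Delta n w.
Proof. by case: poissonT => _ Tlt _ _ _; rewrite /Delta /= subr_gt0. Qed.

(** The start, the lengths of the cycles and the driving motions, as one
    independent family: the waiting times replace the Poisson process in [G]. *)
Let K := split_system G 1%N (fun n => sigma_rv (Delta n)).

Let G_sigma (k : nat) : exists H, [/\ H `<=` measurable & G k.+1 = <<s H >>].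
Proof.
case: k => [|n] /=.
  exists (\bigcup_(i in setT) sigma_rv (T i)); split => //.
  by move=> A [i _]; exact: sigma_rv_sub_measurable.
exists (\bigcup_(i in `[0, +oo[) sigma_rv (W n i)); split => //.
by move=> A [i _]; exact: sigma_rv_sub_measurable.
Qed.

Let Gm k : G k `<=` measurable.
Proof.
case: k => [|k]; first exact: sigma_rv_sub_measurable.
by have [H [Hm ->]] := G_sigma k; exact: sigma_measurable.
Qed.

Let Km k : K k `<=` measurable.
Proof.
case: k => [i|n] /=; last exact: sigma_rv_sub_measurable.
by case: ifP => _; [move=> _ ->|exact: Gm].
Qed.

Let KI k : setI_closed (K k).
Proof.
case: k => [i|n] /=; last exact: sigma_rv_setI.
case: ifP => _; first by move=> _ _ -> ->; rewrite setIT.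
case: i => [|i]; first exact: sigma_rv_setI.
by have [H [_ ->]] := G_sigma i; exact: sigma_setI.
Qed.

Let KT k : K k setT.
Proof.
case: k => [i|n] /=; last exact: sigma_rv_setT.
case: ifP => // _; case: i => [|i]; first exact: sigma_rv_setT.
by have [H [_ ->]] := G_sigma i; exact: sigma_setT.
Qed.

Let indK : independent_systems P K.
Proof.
apply: independent_split => //; first by case: poissonT.
move=> s F sF; apply: sigma_bigcap_seq => j /sF.
apply: sigma_rv_adapted; apply/adaptedP; apply: measurable_funB; apply/adaptedP => B mB.
  by apply: sub_sigma_algebra; exists j.+1 => //; exact: adapted_sigma_rv.
by apply: sub_sigma_algebra; exists j => //; exact: adapted_sigma_rv.
Qed.

Let sig (J : set (nat + nat)) := <<s \bigcup_(k in J) K k >>.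

Let sigm J : sig J `<=` measurable.
Proof. by apply: sigma_measurable => A [k _]; exact: Km. Qed.

Let indep J1 J2 : J1 `&` J2 = set0 -> indep2 P (sig J1) (sig J2).
Proof. by move=> J12; apply: (indep2_group Km KI KT indK J12). Qed.

(** The indices in [K] of what drives the [n]-th cycle, its length excepted. *)
Let motion n : set (nat + nat) :=
  [set k | k = inl n.+2 \/ (n = 0%N /\ k = inl 0%N)].

Let adapted_xi n : adapted (sig (motion n)) (xi n).
Proof.
case: n => [|n] B mB.
  apply: sub_sigma_algebra; exists (inl 0%N); first by right.
  exact: adapted_sigma_rv.
have /adaptedP := @measurable_cst _ _
  (g_sigma_algebraType (\bigcup_(k in motion n.+1) K k)) R setT xR.
exact.
Qed.

Let adapted_sigma n : adapted (sig (motion n)) (sigma n).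
Proof.
apply: sub_adapted (adapted_brownian_exit (xi_itv n) (bmW n)).
apply: smallest_sub; first exact: smallest_sigma_algebra.
move=> A [xA|WA]; first exact: (sigma_rv_adapted (@adapted_xi n)).
by apply: sub_sigma_algebra; exists (inl n.+2) => //; left.
Qed.

Let xiW n : indep2 P (sigma_rv (xi n)) (sigma_process `[0, +oo[ (W n)).
Proof.
have : indep2 P (sig (motion n `\ inl n.+2)) (sig [set inl n.+2]).
  by apply: indep; apply/seteqP; split => // k [[_ +] +].
apply: indep2_sub.
  apply: sigma_rv_adapted; case: n => [|n].
    move=> B mB; apply: sub_sigma_algebra; exists (inl 0%N).
      by split => //; right.
    exact: adapted_sigma_rv.
  by apply/adaptedP; exact: (measurable_cst xR).
by move=> A WA; apply: sub_sigma_algebra; exists (inl n.+2).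
Qed.

Let adapted_Delta n : adapted (sig [set inr n]) (Delta n).
Proof.
move=> B mB; apply: sub_sigma_algebra; exists (inr n) => //.
exact: adapted_sigma_rv.
Qed.

Let motion_clock n (A : set (\bar R)) (B : set R) : measurable A -> measurable B ->
  P (sigma n @^-1` A `&` Delta n @^-1` B) =
  (P (sigma n @^-1` A) * P (Delta n @^-1` B))%E.
Proof.
move=> mA mB; have : indep2 P (sig (motion n)) (sig [set inr n]).
  by apply: indep; apply/seteqP; split => // k [[->|[_ ->]]].
by apply; [exact: adapted_sigma|exact: adapted_Delta].
Qed.

Let msigma n : measurable_fun setT (sigma n).
Proof. exact: (measurable_brownian_exit (@mxi n) (xi_itv n) (bmW n)). Qed.

Let sigma_gt0 n w : (0 < sigma n w)%E.
Proof. exact: (brownian_exit_gt0 (xi_itv n) (bmW n)). Qed.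

(** Seen from its beginning, the [n]-th cycle is worth [Z n] if the exit occurs in
    it, and otherwise multiplies by [Y n] what follows. *)
Let Z n w : R := if (sigma n w < (Delta n w)%:E)%E
  then discount lambda (sigma n w) else 0.
Let Y n w : R := if ((Delta n w)%:E <= sigma n w)%E
  then expR (- lambda * Delta n w) else 0.
(** The discounted exit time of the motion that begins at the [n]-th event. *)
Let tail n w : R := discount lambda (path_exit b (fun t => X (T n w + t) w)).
Let Q n w : R := \prod_(k < n) Y k w.
Let S n w : R := \sum_(k < n) Q k w * Z k w.

Let motion_continuous n w :
  {within `[0, +oo[, continuous (fun t => xi n w + W n t w)}.
Proof.
case: (bmW n) => _ Wc _ _ t; apply: cvgD; first exact: cvg_cst.
exact: Wc.
Qed.

Let motion_start n w : 0 < xi n w + W n 0 w < b.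
Proof. by case: (bmW n) => W0 _ _ _; rewrite W0 addr0. Qed.

Let restart n w : 0 < X (T n.+1 w + 0) w < b.
Proof.
rewrite addr0 (XE (n := n.+1)); last first.
  by case: poissonT => _ Tlt _ _ _; rewrite lexx Tlt.
by rewrite subrr; case: (bmW n.+1) => W0 _ _ _; rewrite W0 addr0.
Qed.

Let during_cycle n w t : 0 <= t < Delta n w ->
  X (T n w + t) w = xi n w + W n t w.
Proof.
move=> /andP[t0 tD]; rewrite (XE (n := n)); first by rewrite addrAC subrr add0r.
by rewrite lerDl t0 -ltrBrDl.
Qed.

Let after_cycle n w t : 0 <= t -> X (T n w + (Delta n w + t)) w = X (T n.+1 w + t) w.
Proof. by move=> t0; congr (X _ _); rewrite /Delta /=; ring. Qed.

Let tailE n w : tail n w = Z n w + Y n w * tail n.+1 w.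
Proof.
exact: (discount_path_exit_reset (@motion_continuous n w) (motion_start n w)
  (restart n w) (Delta_gt0 n w) (@during_cycle n w) (@after_cycle n w)).
Qed.

Let shift0 w : (fun t => X (T 0 w + t) w) = X^~ w.
Proof. by apply/funext => t; case: poissonT => -> _ _ _ _; rewrite add0r. Qed.

Lemma resetting_exit_gt0 w : (0 < path_exit b (X^~ w))%E.
Proof.
rewrite -shift0.
exact: (path_exit_reset_gt0 (@motion_continuous 0 w) (motion_start 0 w)
  (restart 0 w) (Delta_gt0 0 w) (@during_cycle 0 w) (@after_cycle 0 w)).
Qed.

Let Z_ge0 n w : 0 <= Z n w.
Proof. by rewrite /Z; case: ifP => // _; exact: discount_ge0. Qed.

Let Y_ge0 n w : 0 <= Y n w.
Proof. by rewrite /Y; case: ifP => // _; exact: expR_ge0. Qed.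

Let Q_ge0 n w : 0 <= Q n w.
Proof. exact: prodr_ge0. Qed.

Let S_ge0 n w : 0 <= S n w.
Proof. by apply: sumr_ge0 => i _; exact: mulr_ge0. Qed.

Let tail_itv n w : 0 <= tail n w <= 1.
Proof.
rewrite discount_ge0 discount_le1// ?(ltW lambda0)//.
by apply: le_ereal_inf_tmp => _ [t [t0 _] <-]; rewrite lee_fin ltW.
Qed.

Let tail0E n w : tail 0 w = S n w + Q n w * tail n w.
Proof.
elim: n => [|n ->]; first by rewrite /S /Q !big_ord0 add0r mul1r.
by rewrite /S /Q !big_ord_recr /= -/(Q n w) [in LHS]tailE; ring.
Qed.

Let Q_le n w : Q n w <= expR (- lambda * T n w).
Proof.
elim: n => [|n IH].
  by case: poissonT => T0 _ _ _ _; rewrite /Q big_ord0 T0 mulr0 expR0.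
rewrite /Q big_ord_recr /= -/(Q n w).
have -> : expR (- lambda * T n.+1 w) =
    expR (- lambda * T n w) * expR (- lambda * Delta n w).
  by rewrite -expRD /Delta /=; congr expR; ring.
apply: ler_pM => //.
by rewrite /Y; case: ifP => // _; exact: expR_ge0.
Qed.

Let cvg_Q w : Q n w @[n --> \oo] --> 0.
Proof.
apply: (@squeeze_cvgr _ _ _ _ (cst 0) (fun n => expR (- lambda * T n w))).
- by apply: nearW => n; rewrite Q_ge0 Q_le.
- exact: cvg_cst.
- have exp0 : expR (- (lambda * x)) @[x --> +oo] --> 0.
    apply: (@cvg_comp _ _ _ (fun x => lambda * x) (fun x => expR (- x)) _
      (pinfty_nbhs R)); last exact: cvgr_expR.
    exact: gt0_cvgMry.
  rewrite (_ : (fun n => _) = (fun x => expR (- (lambda * x))) \o (T^~ w)).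
    by apply: cvg_comp exp0; case: poissonT => _ _ Too _ _; exact: Too.
  by apply/funext => n /=; rewrite mulNr.
Qed.

Let cycle n : set (nat + nat) := motion n `|` [set inr n].

(** The indices in [K] of the start and of the first [n] cycles. *)
Let past n : set (nat + nat) := [set k | match k with
  inl i => (i < n.+2)%N | inr j => (j < n)%N end].

Let sig_sub J J' : J `<=` J' -> sig J `<=` sig J'.
Proof.
by move=> JJ; apply: sub_sigma_algebra2; apply: bigcup_subset.
Qed.

Let past_cycle n : indep2 P (sig (past n.+1)) (sig (cycle n.+1)).
Proof.
apply: indep; apply/seteqP; split => // k [].
by case: k => [i|j] /= + [[[ij]|[]]|[ij]]//; rewrite ?ij ?ltnn.
Qed.

Let cycle_measurable n : measurable_fun setT
    (sigma n : g_sigma_algebraType (\bigcup_(k in cycle n) K k) -> \bar R) /\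
  measurable_fun setT
    (Delta n : g_sigma_algebraType (\bigcup_(k in cycle n) K k) -> R).
Proof.
split; apply/adaptedP.
  by apply: sub_adapted (@adapted_sigma n); apply: sig_sub => k; left.
by apply: sub_adapted (@adapted_Delta n); apply: sig_sub => k; right.
Qed.

Let adapted_Z n : adapted (sig (cycle n)) (Z n).
Proof.
have [ms mD] := cycle_measurable n.
apply/adaptedP; apply: measurable_fun_ifT => //.
  by apply: measurable_fun_lte => //; exact/measurable_EFinP.
by apply: measurableT_comp => //; exact: measurable_discount.
Qed.

Let adapted_Y n : adapted (sig (cycle n)) (Y n).
Proof.
have [ms mD] := cycle_measurable n.
apply/adaptedP; apply: measurable_fun_ifT => //.
  by apply: measurable_fun_lee => //; exact/measurable_EFinP.
by apply: measurableT_comp => //; exact: measurable_funM.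
Qed.

Let adapted_Q n : adapted (sig (past n)) (Q n).
Proof.
elim: n => [|n IH].
  rewrite (_ : Q 0 = cst 1).
    by apply/adaptedP; exact: measurable_cst.
  by apply/funext => w; rewrite /Q big_ord0.
rewrite (_ : Q n.+1 = Q n \* Y n).
  apply/adaptedP; apply: measurable_funM; apply/adaptedP.
    apply: sub_adapted IH; apply: sig_sub => -[i|j] /=; exact: ltnW.
  apply: sub_adapted (@adapted_Y n); apply: sig_sub => k [[->|[-> ->]]|->] //=.
by apply/funext => w; rewrite /Q big_ord_recr.
Qed.

Let mZ n : measurable_fun setT (Z n).
Proof. by move=> _ B mB; rewrite setTI; apply: sigm; exact: adapted_Z. Qed.

Let mY n : measurable_fun setT (Y n).
Proof. by move=> _ B mB; rewrite setTI; apply: sigm; exact: adapted_Y. Qed.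

Let mQ n : measurable_fun setT (Q n).
Proof. by move=> _ B mB; rewrite setTI; apply: sigm; exact: adapted_Q. Qed.

Let mS n : measurable_fun setT (S n).
Proof.
by apply: measurable_sum => k; exact: measurable_funM.
Qed.

Let gamma := lambda + r.
Let p n : R := fine (\int[P]_w (discount gamma (sigma n w))%:E)%E.
Let q := r / gamma.

Let gamma0 : 0 < gamma.
Proof. exact: addr_gt0. Qed.

Let discount_sigma n w : 0 <= discount gamma (sigma n w) <= 1.
Proof. by rewrite discount_ge0 discount_le1// ltW// sigma_gt0. Qed.

Let mdiscount n : measurable_fun setT (fun w => discount gamma (sigma n w)).
Proof. by apply: measurableT_comp => //; exact: measurable_discount. Qed.

Let pE n : (\int[P]_w (discount gamma (sigma n w))%:E = (p n)%:E)%E.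
Proof.
rewrite /p fineK// ge0_fin_numE.
  apply: (@le_lt_trans _ _ (\int[P]_w 1%:E)%E); last first.
    by rewrite probability_integral_cst ltry.
  apply: ge0_le_integral => //.
  - by move=> w _; rewrite lee_fin; case/andP: (discount_sigma n w).
  - exact/measurable_EFinP.
  - by move=> w _; rewrite lee_fin; case/andP: (discount_sigma n w).
by apply: integral_ge0 => w _; rewrite lee_fin; case/andP: (discount_sigma n w).
Qed.

Let p_ge0 n : 0 <= p n.
Proof.
rewrite -lee_fin -pE.
by apply: integral_ge0 => w _; rewrite lee_fin; case/andP: (discount_sigma n w).
Qed.

Let clock_law n (A : set R) : measurable A ->
  P (Delta n @^-1` A) = exponential_prob r A.
Proof. by case: poissonT => _ _ _ + _; apply. Qed.

Let expectation_Z n : (\int[P]_w (Z n w)%:E = (p n)%:E)%E.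
Proof.
rewrite -pE; apply: (@expectation_before_clock _ _ _ P r lambda (Delta n)) => //.
- by move=> A mA; exact: clock_law.
- by move=> A B mA mB; exact: motion_clock.
Qed.

Let expectation_Y n : (\int[P]_w (Y n w)%:E = (q * (1 - p n))%:E)%E.
Proof.
transitivity (\int[P]_w (q * (1 - discount gamma (sigma n w)))%:E)%E.
  apply: (@expectation_clock_first _ _ _ P r lambda (Delta n)) => //.
  - by move=> A mA; exact: clock_law.
  - by move=> A B mA mB; exact: motion_clock.
have m1 : measurable_fun setT (fun w => 1 - discount gamma (sigma n w)).
  exact: measurable_funB.
have g1 w : 0 <= 1 - discount gamma (sigma n w).
  by rewrite subr_ge0; case/andP: (discount_sigma n w).
have d0 w : 0 <= discount gamma (sigma n w) by case/andP: (discount_sigma n w).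
have q0 : 0 <= q by rewrite divr_ge0 ?(ltW r0) ?(ltW gamma0).
rewrite (ge0_expectationZ P m1 g1 q0) [RHS]EFinM; congr (_ * _)%E.
have := ge0_expectationD P m1 (mdiscount n) g1 d0; rewrite pE.
under eq_integral do rewrite subrK.
by rewrite probability_integral_cst EFinB => ->; rewrite addeK.
Qed.

Let theta := Num.sqrt (2 * gamma).
Let K2 := expR (theta * (b / 2)) + expR (- (theta * (b / 2))).

Let motion_laplace n : ((p n * K2)%:E =
  \int[P]_w (expR (theta * (xi n w - b / 2)) + expR (- (theta * (xi n w - b / 2))))%:E)%E.
Proof.
have th0 : theta != 0 by rewrite gt_eqF// sqrtr_gt0 mulr_gt0.
have thE : theta ^+ 2 / 2 = gamma.
  by rewrite sqr_sqrtr ?mulr_ge0// ?(ltW gamma0)// mulrC mulKf.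
have K20 : 0 <= K2 by rewrite addr_ge0// expR_ge0.
rewrite -(brownian_exit_laplace (@mxi n) (xi_itv n) (bmW n) (@xiW n) th0) thE.
have d0 w : 0 <= discount gamma (sigma n w) by case/andP: (discount_sigma n w).
under eq_integral do rewrite mulrC.
by rewrite (ge0_expectationZ P (mdiscount n) d0 K20) pE -EFinM mulrC.
Qed.

Let reset_motion_laplace n :
  p n.+1 * K2 = expR (theta * (xR - b / 2)) + expR (- (theta * (xR - b / 2))).
Proof.
apply: EFin_inj; rewrite motion_laplace.
exact: (probability_integral_cst P
  (expR (theta * (xR - b / 2)) + expR (- (theta * (xR - b / 2))))).
Qed.

(** The value of a motion that restarts from [xR]: see [vE]. *)
Let v := p 1 / (1 - q * (1 - p 1)).

Let p_const n : p n.+1 = p 1.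
Proof.
have K20 : K2 != 0 by rewrite gt_eqF// addr_gt0// expR_gt0.
by apply: (mulIf K20); rewrite !reset_motion_laplace.
Qed.

Let p_le1 n : p n <= 1.
Proof.
rewrite -lee_fin -pE -(probability_integral_cst P 1).
apply: ge0_le_integral => //.
- by move=> w _; rewrite lee_fin; case/andP: (discount_sigma n w).
- exact/measurable_EFinP.
- by move=> w _; rewrite lee_fin; case/andP: (discount_sigma n w).
Qed.

Let q_itv : 0 < q < 1.
Proof.
rewrite divr_gt0//= ltr_pdivrMr// mul1r /gamma ltrDr//.
Qed.

Let vE : v = p 1 + q * (1 - p 1) * v.
Proof.
have /andP[q0 q1] := q_itv; have p1 := p_le1 1; have p0 := p_ge0 1.
rewrite /v; field; rewrite gt_eqF//; nra.
Qed.

Let v_itv : 0 <= v <= 1.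
Proof.
have /andP[q0 q1] := q_itv; have p1 := p_le1 1; have p0 := p_ge0 1.
have d0 : 0 < 1 - q * (1 - p 1) by nra.
rewrite /v divr_ge0 ?(ltW d0)//= ler_pdivrMr// mul1r; nra.
Qed.

(** The expansion [tail0E] of the discounted exit time, with the future after
    the [n]-th event replaced by its expected value. *)
Let estimate n w := S n w + Q n w * v.

(** The [n.+1]-th cycle is independent of its past [Q n.+1], and
    Z + Y v has expectation [v] by [vE]; so one more cycle does not change the
    expectation.  The first cycle is different, its start being [eta]. *)
Let expectation_estimate n : (\int[P]_w (estimate n.+1 w)%:E =
  (p 0 + q * (1 - p 0) * v)%:E)%E.
Proof.
have v0 : 0 <= v by case/andP: v_itv.
have ZY n' : (\int[P]_w (Z n' w + Y n' w * v)%:E =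
    (p n' + q * (1 - p n') * v)%:E)%E.
  have mYv : measurable_fun setT (fun w => v * Y n' w) by exact: measurable_funM.
  under eq_integral do rewrite (mulrC _ v).
  rewrite (ge0_expectationD P (mZ n') mYv (Z_ge0 n') (fun w => mulr_ge0 v0 (Y_ge0 n' w))).
  rewrite (ge0_expectationZ P (mY n') (Y_ge0 n') v0) expectation_Z expectation_Y.
  by rewrite -EFinM -EFinD mulrC.
have estimateS n' w : estimate n'.+1 w = S n' w + Q n' w * (Z n' w + Y n' w * v).
  by rewrite /estimate /S /Q !big_ord_recr /= -/(Q n' w); ring.
elim: n => [|n IH].
  rewrite -ZY; apply: eq_integral => w _; rewrite estimateS /S /Q !big_ord0.
  by rewrite add0r mul1r.
rewrite -IH; under eq_integral do rewrite estimateS.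
have mYv n' : measurable_fun setT (fun w => Y n' w * v).
  exact: measurable_funM.
have mZY : measurable_fun setT (fun w => Z n.+1 w + Y n.+1 w * v).
  exact: measurable_funD.
have ZY_ge0 w : 0 <= Z n.+1 w + Y n.+1 w * v.
  by rewrite addr_ge0// mulr_ge0.
have mQv : measurable_fun setT (fun w => Q n.+1 w * v) by exact: measurable_funM.
have mQZY : measurable_fun setT (fun w => Q n.+1 w * (Z n.+1 w + Y n.+1 w * v)).
  exact: measurable_funM.
rewrite (ge0_expectationD P (mS _) mQZY (S_ge0 _)
  (fun w => mulr_ge0 (Q_ge0 _ w) (ZY_ge0 w))).
rewrite (ge0_expectationD P (mS _) mQv (S_ge0 _) (fun w => mulr_ge0 (Q_ge0 _ w) v0)).
congr (_ + _)%E.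
have adapted_ZY : adapted (sig (cycle n.+1)) (fun w => Z n.+1 w + Y n.+1 w * v).
  apply/adaptedP; apply: measurable_funD; first by apply/adaptedP; exact: adapted_Z.
  by apply: measurable_funM => //; apply/adaptedP; exact: adapted_Y.
rewrite (indep_expectation (@sigm _) (@sigm _) (@past_cycle n) (@adapted_Q n.+1)
  adapted_ZY (Q_ge0 _) ZY_ge0).
rewrite ZY p_const -vE; under [RHS]eq_integral do rewrite mulrC.
by rewrite (ge0_expectationZ P (mQ _) (Q_ge0 _) v0) muleC.
Qed.

(** The error is [Q n * (tail n - v)], and [Q n] is at most
    exp (- lambda * T n). *)
Let cvg_estimate w : estimate n w @[n --> \oo] --> tail 0 w.
Proof.
apply/cvgrPdist_le => e e0; move/cvgrPdist_le: (cvg_Q w) => /(_ _ e0).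
apply: filterS => n; rewrite sub0r normrN (ger0_norm (Q_ge0 n w)).
apply: le_trans; rewrite /estimate (tail0E n w) opprD addrACA subrr add0r -mulrBr.
rewrite normrM (ger0_norm (Q_ge0 n w)) ler_piMr//.
have /andP[t0 t1] := tail_itv n w; have /andP[v0 v1] := v_itv.
by rewrite ler_norml; apply/andP; split; lra.
Qed.

Let mestimate n : measurable_fun setT (estimate n).
Proof. by apply: measurable_funD => //; exact: measurable_funM. Qed.

Let mtail : measurable_fun setT (tail 0).
Proof.
by apply: (measurable_fun_cvg mestimate) => w _; exact: cvg_estimate.
Qed.

Let estimate_itv n w : 0 <= estimate n w <= 2.
Proof.
have /andP[v0 v1] := v_itv; have Q0 := Q_ge0 n w.
rewrite (addr_ge0 (S_ge0 n w) (mulr_ge0 Q0 v0))/=.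
have S1 : S n w <= 1.
  have /andP[t0 t1] := tail_itv 0 w; apply: le_trans t1.
  by rewrite (tail0E n w) lerDl mulr_ge0//; case/andP: (tail_itv n w).
have Q1 : Q n w <= 1.
  apply: le_trans (Q_le n w) _; rewrite -expR0 ler_expR mulNr oppr_le0.
  rewrite mulr_ge0 ?(ltW lambda0)//.
  case: poissonT => T0 Tlt _ _ _; elim: n {Q0 S1} => [|n IH]; first by rewrite T0.
  exact: le_trans IH (ltW (Tlt _ _)).
have : Q n w * v <= 1 by rewrite mulr_ile1.
by rewrite /estimate; lra.
Qed.

Let tail0_exit : tail 0 = (fun w => discount lambda (path_exit b (X^~ w))).
Proof.
by apply/funext => w; rewrite /tail shift0.
Qed.

(** A pointwise limit of the measurable estimates. *)
Lemma measurable_discount_exit :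
  measurable_fun setT (fun w => discount lambda (path_exit b (X^~ w))).
Proof. by rewrite -tail0_exit. Qed.

(** Dominated convergence applies to the estimates, which are bounded by 2. *)
Let expectation_tail : (\int[P]_w (tail 0 w)%:E = (p 0 + q * (1 - p 0) * v)%:E)%E.
Proof.
have mE n : measurable_fun setT (fun w => (estimate n.+1 w)%:E).
  exact/measurable_EFinP.
have mt : measurable_fun setT (fun w => (tail 0 w)%:E) by exact/measurable_EFinP.
have cvg_E : {ae P, forall w, setT w ->
    (estimate n.+1 w)%:E @[n --> \oo] --> (tail 0 w)%:E}.
  apply: aeW => w _; apply: cvg_EFin; first exact: nearW.
  by have := @cvg_estimate w; rewrite -cvg_shiftS.
have i2 : P.-integrable setT (fun=> 2%:E).
  exact: finite_measure_integrable_cst.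
have bE : {ae P, forall w n, setT w -> (`|(estimate n.+1 w)%:E| <= 2%:E)%E}.
  apply: aeW => w n _; have /andP[e0 e2] := estimate_itv n.+1 w.
  by rewrite abse_EFin ger0_norm// lee_fin.
have [_ _ cvgE] := dominated_convergence measurableT mE mt cvg_E i2 bE.
have constE : (fun n => \int[P]_w (estimate n.+1 w)%:E)%E =
    cst (p 0 + q * (1 - p 0) * v)%:E.
  by apply/funext => n; exact: expectation_estimate.
have cvgE' : (fun n => \int[P]_w (estimate n.+1 w)%:E)%E @ \oo -->
  (\int[P]_w (tail 0 w)%:E)%E by exact: cvgE.
rewrite constE in cvgE'.
by apply: (cvg_unique _ cvgE') => //; exact: cvg_cst.
Qed.

Lemma renewal_laplace
  (phi := fun x => (expR (theta * (x - b / 2)) + expR (- (theta * (x - b / 2)))) / K2) :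
  exists2 phi0, (\int[P]_w (phi (eta w))%:E = phi0%:E)%E &
  (\int[P]_w (discount lambda (path_exit b (X^~ w)))%:E =
    (phi0 + q * (1 - phi0) * (phi xR / (1 - q * (1 - phi xR))))%:E)%E.
Proof.
have K20 : 0 < K2 by rewrite addr_gt0// expR_gt0.
have phiR : p 1 = phi xR.
  by apply: (mulIf (lt0r_neq0 K20)); rewrite reset_motion_laplace /phi divfK ?gt_eqF.
exists (p 0); last by have := expectation_tail; rewrite tail0_exit /v phiR.
rewrite /phi; under eq_integral do rewrite mulrC.
rewrite (@ge0_expectationZ _ _ _ P); last 3 first.
- apply: measurable_funD; apply: measurableT_comp => //; last apply: measurableT_comp => //;
    apply: measurable_funM => //; apply: measurable_funB => //.
- by move=> w; rewrite addr_ge0// expR_ge0.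
- by rewrite invr_ge0 ltW.
by rewrite -(motion_laplace 0) -EFinM mulrC mulfK ?gt_eqF.
Qed.

End renewal.

(** * Laplace transforms *)

Section discount_density.
Context {d : measure_display} {Omega : measurableType d} {R : realType}
  (P : probability Omega R) (lambda : R) (tau : Omega -> \bar R) (f : R -> R).
Hypothesis lambda0 : 0 < lambda.
Hypothesis tau0 : forall w, (0 < tau w)%E.
Hypothesis mtau : measurable_fun setT (fun w => discount lambda (tau w)).
Hypothesis mf : measurable_fun (`]0, +oo[%classic : set R) f.
Hypothesis f0 : forall x : R, `]0, +oo[%classic x -> 0 <= f x.
Hypothesis tauE : forall t, 0 < t ->
  (P [set w | tau w <= t%:E] = \int[lebesgue_measure]_(s in `]0%R, t]) (f s)%:E)%E.
Local Notation leb := (@lebesgue_measure R).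
Local Notation pdf := (exponential_pdf lambda).

Let pdf_ge0 t : 0 <= pdf t.
Proof. exact/exponential_pdf_ge0/ltW. Qed.

Let mpdf : measurable_fun setT pdf.
Proof. exact: measurable_exponential_pdf. Qed.

(** Expresses the event [tau <= t] through [discount lambda tau], which is known
    to be measurable. *)
Let le_discount s t : (0 < s)%E ->
  (s <= t%:E)%E = (expR (- lambda * t) <= discount lambda s).
Proof.
case: s => [s| |] //= s0; last by rewrite leye_eq/= [RHS]lt_geF// expR_gt0.
by rewrite lee_fin ler_expR !mulNr lerN2 ler_pM2l.
Qed.

Let discount_integral s : (0 < s)%E -> ((discount lambda s)%:E =
  \int[leb]_t (if expR (- lambda * t) <= discount lambda s then pdf t else 0)%:E)%E.
Proof.
move=> s0; under eq_integral => t _ do rewrite -le_discount//.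
case: s s0 => [s| |] // s0; last first.
  by rewrite integral0_eq// => t _; rewrite leye_eq.
rewrite lte_fin in s0.
transitivity (\int[leb]_(t in `[s, +oo[) (pdf t)%:E)%E; last first.
  rewrite [LHS]integral_mkcond; apply: eq_integral => t _; rewrite /patch lee_fin.
  by rewrite mem_setE in_itv/= andbT; case: ifP.
have := integral_exponential_pdf lambda0.
rewrite -(setUv `[s, +oo[%classic) ge0_integral_setU//=; last 4 first.
- exact: measurableC.
- by rewrite setUv; exact/measurable_EFinP.
- by move=> t _; rewrite lee_fin.
- exact/disj_setPCl.
rewrite setCitvr.
have -> : (\int[leb]_(t in `]-oo, s[) (pdf t)%:E = (1 - expR (- lambda * s))%:E)%E.
  rewrite -(exponential_cdf lambda s0) /exponential_prob.
  by rewrite integral_itv_bndo_bndc//; apply/measurable_EFinP; exact: measurable_funTS.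
set I := (\int[leb]_(t in `[s, +oo[) (pdf t)%:E)%E => h.
have -> : (I = I + (1 - expR (- lambda * s))%:E - (1 - expR (- lambda * s))%:E)%E.
  by rewrite addeK.
by rewrite h /= -EFinB; congr EFin; ring.
Qed.

Let F := f \_ `]0, +oo[.

Let F_ge0 x : 0 <= F x.
Proof. by rewrite /F /patch; case: ifPn => // /set_mem; exact: f0. Qed.

Let mF : measurable_fun setT F.
Proof.
have mD : measurable (`]0, +oo[%classic : set R) by [].
by apply/(measurable_restrictT _ mD).
Qed.

Let cdf_integral t : ((pdf t)%:E * P [set w | tau w <= t%:E] =
  (pdf t)%:E * \int[leb]_(s in `]-oo, t]) (F s)%:E)%E.
Proof.
have [t0|t0|->] := ltgtP t 0.
- by rewrite lt0_exponential_pdf// !mul0e.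
- congr (_ * _)%E; rewrite tauE//.
  transitivity (\int[leb]_(s in `]-oo, t] `&` `]0%R, +oo[) (f s)%:E)%E.
    rewrite (_ : `]-oo, t] `&` `]0, +oo[ = `]0, t]%classic)//.
    apply/seteqP; split => s /=; rewrite !in_itv/= andbT; last by move=> /andP[-> ->].
    by move=> [-> ->].
  rewrite integral_mkcondr; apply: eq_integral => s _.
  by rewrite /F /patch; case: ifP.
- congr (_ * _)%E; rewrite (_ : [set w | _] = set0) ?measure0; last first.
    by apply/seteqP; split => // w /=; rewrite leNgt tau0.
  rewrite integral0_eq// => s /=; rewrite in_itv/= /F /patch => s0.
  by rewrite memNset//= in_itv/= andbT ltNge s0.
Qed.

(** The discount exp (- lambda s) is the integral over t >= s of the exponential
    density of rate [lambda].  Exchanging the integrals, both sides become the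
    average against this density of the distribution function of [tau], computed
    from [P] on the left and from [f] on the right. *)
Lemma expectation_discount :
  (\int[P]_w (discount lambda (tau w))%:E =
   \int[leb]_(s in `]0%R, +oo[) (expR (- lambda * s) * f s)%:E)%E.
Proof.
pose f1 (x : Omega * measurableTypeR R) : \bar R :=
  (if expR (- lambda * x.2) <= discount lambda (tau x.1) then pdf x.2 else 0)%:E.
pose f2 (x : measurableTypeR R * measurableTypeR R) : \bar R :=
  (F x.1 * (if x.1 <= x.2 then pdf x.2 else 0))%:E.
have mf1 : measurable_fun setT f1.
  apply/measurable_EFinP; apply: measurable_fun_ifT => //; last first.
    by apply: measurableT_comp; [exact: mpdf|exact: measurable_snd].
  apply: measurable_fun_ler; last first.
    by apply: (measurableT_comp mtau); exact: measurable_fst.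
  by apply: measurableT_comp => //; apply: measurable_funM.
have f10 x : (0 <= f1 x)%E by rewrite /f1 lee_fin; case: ifP.
have mf2 : measurable_fun setT f2.
  apply/measurable_EFinP; apply: measurable_funM.
    by apply: measurableT_comp; [exact: mF|exact: measurable_fst].
  apply: measurable_fun_ifT => //; last first.
    by apply: measurableT_comp; [exact: mpdf|exact: measurable_snd].
  by apply: measurable_fun_ler; [exact: measurable_fst|exact: measurable_snd].
have f20 x : (0 <= f2 x)%E by rewrite /f2 lee_fin mulr_ge0//; case: ifP.
transitivity (\int[P]_w \int[leb]_t f1 (w, t))%E.
  by apply: eq_integral => w _; rewrite discount_integral.
rewrite (@fubini_tonelli _ _ _ _ _ P leb f1 mf1 f10).
transitivity (\int[leb]_s \int[leb]_t f2 (s, t))%E; last first.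
  rewrite [RHS]integral_mkcond; apply: eq_integral => s _.
  rewrite /f2 /F /patch mem_setE in_itv/= andbT; case: ifPn => s0; last first.
    by rewrite integral0_eq// => t _; rewrite mul0r.
  under eq_integral do rewrite EFinM.
  rewrite ge0_integralZl//; last 3 first.
  - apply/measurable_EFinP; apply: measurable_fun_ifT => //.
    by apply: measurable_fun_ler.
  - by move=> t _; rewrite lee_fin; case: ifP.
  - by rewrite lee_fin f0//= in_itv/= s0.
  rewrite -[X in (_ * X)%E](_ : (discount lambda s%:E)%:E = _).
    by rewrite -EFinM mulrC.
  rewrite discount_integral ?lte_fin//; apply: eq_integral => t _.
  by rewrite -le_discount ?lte_fin// lee_fin.
rewrite (@fubini_tonelli _ _ _ _ _ leb leb f2 mf2 f20); apply: eq_integral => t _.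
have mlt : measurable [set w | (tau w <= t%:E)%E].
  rewrite (_ : [set w | _] = [set w | expR (- lambda * t) <= discount lambda (tau w)]).
    rewrite -[X in measurable X]setTI; apply: measurable_fun_ler => //.
  by apply/seteqP; split => w /=; rewrite le_discount.
transitivity ((pdf t)%:E * P [set w | tau w <= t%:E])%E.
  rewrite -[X in P X]setIT -integral_indic// -ge0_integralZl//; last 2 first.
  - by apply/measurable_EFinP; exact: measurable_indic.
  - by rewrite lee_fin.
  apply: eq_integral => w _; rewrite /f1 /= -le_discount// indicE -EFinM.
  by case: ifPn => h; [rewrite mem_set ?mulr1|rewrite memNset ?mulr0//=; exact/negP].
rewrite cdf_integral -ge0_integralZl//; last 3 first.
- by apply/measurable_EFinP; exact: measurable_funTS.
- by move=> s _; rewrite lee_fin.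
- by rewrite lee_fin.
rewrite [LHS]integral_mkcond; apply: eq_integral => s _.
rewrite /f2 /patch mem_setE in_itv/= -EFinM; case: ifP => _; last by rewrite mulr0.
by rewrite mulrC.
Qed.

End discount_density.

Section laplace_transforms.
Context {R : realType}.
Local Notation leb := (@lebesgue_measure R).
Implicit Types (b theta : R) (g : R -> R).

(** Lebesgue measure is invariant under x |-> b - x, as one checks on half-open
    intervals. *)
Lemma integral_reflect b (h : R -> \bar R) :
  measurable_fun (`]0, b[%classic : set R) h ->
  (forall x, `]0, b[%classic x -> (0 <= h x)%E) ->
  (\int[leb]_(x in `]0%R, b[) h x = \int[leb]_(x in `]0%R, b[) h (b - x)%R)%E.
Proof.
move=> mh h0; pose phi x : measurableTypeR R := b - (x : measurableTypeR R).
have mphi : measurable_fun setT (phi : measurableTypeR R -> measurableTypeR R).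
  by apply: measurable_funB => //; exact: measurable_cst.
pose Phi : {mfun measurableTypeR R >-> measurableTypeR R} :=
  HB.pack phi (isMeasurableFun.Build _ _ _ _ _ mphi).
have phiE A : measurable A -> leb A = pushforward leb Phi A.
  apply: (@lebesgue_measure_unique R (pushforward leb Phi)) => _ [[u v] /= uv <-].
  rewrite /pushforward (_ : _ @^-1` _ = `[b - v, b - u[%classic).
    rewrite !lebesgue_measure_itv/= !lte_fin ltrD2l ltrN2.
    by case: ifP => // _; rewrite -!EFinB; congr EFin; ring.
  by apply/seteqP; split => x /=; rewrite !in_itv/= /phi => /andP[? ?];
    apply/andP; split; lra.
transitivity (\int[pushforward leb Phi]_(x in `]0%R, b[) h x)%E.
  by apply: eq_measure_integral => A mA _; exact: phiE.
rewrite ge0_integral_pushforward//; last first.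
  by move=> x /set_mem; exact: h0.
rewrite (_ : Phi @^-1` _ = `]0, b[%classic)//.
by apply/seteqP; split => x /=; rewrite !in_itv/= /phi => /andP[? ?];
    apply/andP; split; lra.
Qed.

(** Holds for infinite [x] too, where both sides vanish. *)
Let fineZ (c : R) (x : \bar R) : 0 < c -> fine (c%:E * x)%E = c * fine x.
Proof.
by move=> c0; case: x => [x| |] //=; rewrite ?gt0_muley ?gt0_muleNy ?lte_fin// mulr0.
Qed.

Lemma laplace_symmetric b g theta : prob_density (`]0, b[%classic : set R) g ->
  (forall u, 0 < u < b / 2 -> g (b / 2 - u) = g (b / 2 + u)) ->
  laplace `]0, b[ g theta = expR (- b * theta) * laplace `]0, b[ g (- theta).
Proof.
move=> [mg g0 _] gsym.
have sym x : 0 < x < b -> g (b - x) = g x.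
  move=> /andP[x0 xb].
  have [xb2|xb2|->] := ltgtP x (b / 2).
  - have -> : b - x = b / 2 + (b / 2 - x) by field.
    have {2}-> : x = b / 2 - (b / 2 - x) by ring.
    by rewrite gsym//; apply/andP; split; lra.
  - have -> : b - x = b / 2 - (x - b / 2) by field.
    have {2}-> : x = b / 2 + (x - b / 2) by ring.
    by rewrite gsym//; apply/andP; split; lra.
  - by congr g; lra.
have mexp th : measurable_fun (`]0, b[%classic : set R) (fun x => (expR (th * x) * g x)%:E).
  apply/measurable_EFinP; apply: measurable_funM => //.
  by apply: measurable_funTS; apply: measurableT_comp => //; exact: measurable_funM.
have pos th (x : R) : `]0, b[%classic x -> (0 <= (expR (th * x) * g x)%:E)%E.
  by move=> xb; rewrite lee_fin mulr_ge0 ?expR_ge0 ?g0.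
rewrite /laplace /Rintegral -fineZ ?expR_gt0//; congr fine.
rewrite (@integral_reflect b _ (mexp (- theta)) (pos (- theta))).
rewrite -ge0_integralZl//; last 2 first.
- exact: mexp.
- by move=> x xb; exact: pos.
apply: eq_integral => x /set_mem; rewrite /= in_itv/= => xb.
rewrite -EFinM sym// mulrA -expRD; congr ((expR _ * _)%:E); ring.
Qed.

End laplace_transforms.

Section exit_probability_algebra.
Context {R : realType}.
Implicit Types (a b x lambda r : R).

(** The Laplace transform at a ^ 2 / 2 of the exit time of a Brownian motion
    started from [x]. *)
Definition exit_transform a b x : R :=
  (expR (a * (x - b / 2)) + expR (- (a * (x - b / 2)))) /
  (expR (a * (b / 2)) + expR (- (a * (b / 2)))).

Lemma sinh_gt0 x : 0 < x -> 0 < sinh x.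
Proof.
by move=> x0; rewrite divr_gt0// subr_gt0 ltr_expR; lra.
Qed.

Let sinh_half a b : sinh (a * b) =
  (expR (a * (b / 2)) + expR (- (a * (b / 2)))) *
  (expR (a * (b / 2)) - expR (- (a * (b / 2)))) / 2.
Proof.
rewrite /sinh; have -> : a * b = a * (b / 2) + a * (b / 2) by field.
rewrite opprD !expRD; congr (_ / _); ring.
Qed.

(** The denominator [calA] arises in this way: it is sinh (a b) times
    lambda + r * exit_transform a b xR. *)
Lemma exit_transform_sinh a b x :
  exit_transform a b x * sinh (a * b) = sinh (a * x) + sinh (a * (b - x)).
Proof.
have K0 : expR (a * (b / 2)) + expR (- (a * (b / 2))) != 0.
  by rewrite gt_eqF// addr_gt0// expR_gt0.
rewrite sinh_half /exit_transform mulrA mulrA divfK//.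
rewrite /sinh -mulrDl; congr (_ / _).
have -> : a * x = a * (x - b / 2) + a * (b / 2) by ring.
have -> : a * (b - x) = a * (b / 2) - a * (x - b / 2) by field.
rewrite !opprD opprK !expRD; ring.
Qed.

Lemma exit_transform_ge0 a b x : 0 <= exit_transform a b x.
Proof. by rewrite divr_ge0// addr_ge0// expR_ge0. Qed.

Lemma renewal_algebra (lambda r phi0 phiR S : R) (q := r / (lambda + r)) :
  0 < lambda -> 0 < r -> 0 < S -> 0 <= phiR ->
  phi0 + q * (1 - phi0) * (phiR / (1 - q * (1 - phiR))) =
  1 - lambda / (lambda * S + r * (phiR * S)) * (S - phi0 * S).
Proof.
move=> l0 r0 S0 p0.
have lr0 : lambda + r != 0 by rewrite gt_eqF// addr_gt0.
have d0 : lambda + r * phiR != 0 by rewrite gt_eqF// ltr_pwDl// mulr_ge0// ltW.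
have -> : 1 - q * (1 - phiR) = (lambda + r * phiR) / (lambda + r).
  by rewrite /q; field.
have -> : lambda * S + r * (phiR * S) = (lambda + r * phiR) * S by ring.
by rewrite /q; field; rewrite lr0 d0 gt_eqF.
Qed.

(** The integral is a combination with positive coefficients of the integrals of
    exp (a x) g x and exp (- a x) g x; its finiteness excludes infinite values of
    these, which [laplace] would read as 0. *)
Lemma expectation_exit_transform {d : measure_display} {Omega : measurableType d}
    (P : probability Omega R) (eta : {RV P >-> R}) (g : R -> R) a b phi0 :
  0 < a -> 0 < b -> prob_density (`]0, b[%classic : set R) g ->
  has_density eta (`]0, b[%classic : set R) g ->
  (\int[P]_w (exit_transform a b (eta w))%:E)%E = phi0%:E ->
  phi0 * sinh (a * b) =
    1 / 2 * ((expR (a * b) - 1) * laplace `]0, b[ g a +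
             (1 - expR (- a * b)) * laplace `]0, b[ g (- a)).
Proof.
move=> a0 b0 [mg g0 _] deneta.
set E := expR (a * (b / 2)); set E' := expR (- (a * (b / 2))).
have EE' : E * E' = 1 by rewrite -expRD subrr expR0.
have E0 : 0 < E by exact: expR_gt0.
have E'0 : 0 < E' by exact: expR_gt0.
have K0 : 0 < E + E' by exact: addr_gt0.
have mexp th : measurable_fun (`]0, b[%classic : set R) (fun x => (expR (th * x) * g x)%:E).
  apply/measurable_EFinP; apply: measurable_funM => //.
  by apply: measurable_funTS; apply: measurableT_comp => //; exact: measurable_funM.
have pos th (x : R) : `]0, b[%classic x -> (0 <= (expR (th * x) * g x)%:E)%E.
  by move=> xb; rewrite lee_fin mulr_ge0 ?expR_ge0 ?g0.
have c1' : 0 < E' / (E + E') by exact: divr_gt0.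
have c2' : 0 < E / (E + E') by exact: divr_gt0.
have c1 := ltW c1'; have c2 := ltW c2'.
rewrite (@expectation_density _ _ _ P eta `]0, b[%classic g
  (fun x => (exit_transform a b x)%:E))//; last 2 first.
- apply/measurable_EFinP; apply: measurable_funM => //; apply: measurable_funD.
    by apply: measurableT_comp => //; apply: measurable_funM => //; exact: measurable_funB.
  apply: measurableT_comp => //; apply: measurableT_comp => //.
  by apply: measurable_funM => //; exact: measurable_funB.
- by move=> x; rewrite lee_fin exit_transform_ge0.
set I := fun th => (\int[lebesgue_measure]_(x in `]0%R, b[) (expR (th * x) * g x)%:E)%E.
have -> : (\int[lebesgue_measure]_(x in `]0%R, b[) ((exit_transform a b x)%:E * (g x)%:E) =
    (E' / (E + E'))%:E * I a + (E / (E + E'))%:E * I (- a)%R)%E.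
  rewrite /I -!ge0_integralZl//; try exact: mexp; try exact: pos.
  rewrite -ge0_integralD//; last 4 first.
  - by move=> x xb; rewrite mule_ge0 ?lee_fin// -?lee_fin ?pos.
  - by apply: measurable_funeM; exact: mexp.
  - by move=> x xb; rewrite mule_ge0 ?lee_fin// -?lee_fin ?pos.
  - by apply: measurable_funeM; exact: mexp.
  apply: eq_integral => x _; rewrite -!EFinM -EFinD; congr EFin.
  rewrite /exit_transform -/E -/E'.
  have -> : expR (a * (x - b / 2)) = expR (a * x) * E'.
    by rewrite -expRD; congr expR; ring.
  have -> : expR (- (a * (x - b / 2))) = expR (- a * x) * E.
    by rewrite -expRD; congr expR; ring.
  by field; rewrite gt_eqF.
have I0 th : (0 <= I th)%E by apply: integral_ge0 => x xb; exact: pos.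
have lapE th : laplace `]0, b[ g th = fine (I (- th)) by [].
rewrite !lapE opprK.
case: (I a) (I0 a) => [i1| |] //; last first.
  rewrite gt0_muley ?lte_fin// addye// gt_eqF//.
  by rewrite (@lt_le_trans _ _ 0%E)// mule_ge0// lee_fin.
case: (I (- a)) (I0 (- a)) => [i2| |] //; last by rewrite gt0_muley ?lte_fin.
move=> _ _; rewrite -!EFinM -EFinD => -[<-] /=.
rewrite sinh_half -/E -/E'.
have -> : expR (a * b) = E * E by rewrite -expRD; congr expR; field.
have -> : expR (- a * b) = E' * E' by rewrite -expRD; congr expR; field.
have -> : E' = E^-1 by rewrite -[RHS]mul1r -EE' mulrAC divff ?mul1r// gt_eqF.
by field; rewrite !gt_eqF// addr_gt0// mulr_gt0.
Qed.

End exit_probability_algebra.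

(** * The inverse exit problem *)

Section main_formula.
Context {d : measure_display} {Omega : measurableType d} {R : realType}
  (P : probability Omega R) (b r xR : R) (eta : {RV P >-> R})
  (X : R -> Omega -> R) (f g : R -> R).
Hypothesis r0 : 0 < r.
Hypothesis xR_itv : 0 < xR < b.
Hypothesis eta_itv : forall w, 0 < eta w < b.
Hypothesis resetX : resetting_brownian_motion r xR eta X.
Hypothesis densf : prob_density (`]0, +oo[%classic : set R) f.
Hypothesis solg : ifet_solution b eta X f g.

(** [renewal_laplace] computes the expectation of exp (- lambda tau) from [eta],
    and [expectation_discount] from [f]. *)
Lemma laplace_exit_density lambda (a := alpha r lambda) : 0 < lambda ->
  laplace `]0, +oo[ f lambda = 1 - lambda / calA b r xR lambda *
    (sinh (a * b) - 1 / 2 * ((expR (a * b) - 1) * laplace `]0, b[ g a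
                             + (1 - expR (- a * b)) * laplace `]0, b[ g (- a))).
Proof.
move=> lambda0; have [densg deneta tauE] := solg.
have b0 : 0 < b by case/andP: xR_itv; exact: lt_trans.
have a0 : 0 < a by rewrite sqrtr_gt0 mulr_gt0// addr_gt0.
have [T [W [poissonT bmW indG XE]]] := resetX.
have [phi0 phi0E expE] := renewal_laplace r0 lambda0 xR_itv eta_itv poissonT bmW indG XE.
have mdisc := measurable_discount_exit r0 lambda0 xR_itv eta_itv poissonT bmW XE.
have tau0 := resetting_exit_gt0 xR_itv eta_itv poissonT bmW XE.
have [mf f0 _] := densf.
have := expectation_discount lambda0 tau0 mdisc mf f0 tauE.
rewrite expE => fE.
have -> : laplace `]0, +oo[ f lambda = fine (\int[lebesgue_measure]_(s in `]0%R, +oo[)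
    (expR (- lambda * s) * f s)%:E)%E by [].
rewrite -fE /= -/(exit_transform a b xR).
rewrite (renewal_algebra phi0 lambda0 r0 (sinh_gt0 (mulr_gt0 a0 b0))
  (exit_transform_ge0 a b xR)).
rewrite exit_transform_sinh.
rewrite (expectation_exit_transform a0 b0 densg deneta phi0E).
have -> : calA b r xR lambda = lambda * sinh (a * b) +
    r * (sinh (a * xR) + sinh (a * (b - xR))) by rewrite /calA -/a; ring.
by [].
Qed.

End main_formula.

Unset Implicit Arguments.

Theorem proposition3p1 (R : realType) (d : measure_display)
    (Omega : measurableType d) (P : probability Omega R)
    (b r xR : R) (hb : 0 < b) (hr : 0 < r) (hxR : 0 < xR < b)
    (eta : {RV P >-> R}) (heta : forall w, 0 < eta w < b)
    (X : R -> Omega -> R) (hX : resetting_brownian_motion r xR eta X)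
    (f : R -> R) (hf : prob_density `]0, +oo[ f)
    (g : R -> R) (hg : ifet_solution b eta X f g) :
  let fhat := laplace `]0, +oo[ f in
  let ghat := laplace `]0, b[ g in
  (forall lambda, 0 < lambda ->
    let a := alpha r lambda in
    fhat lambda = 1 - lambda / calA b r xR lambda *
      (sinh (a * b) - 1 / 2 * ((expR (a * b) - 1) * ghat a
                               + (1 - expR (- a * b)) * ghat (- a)))) /\
  ((forall u, 0 < u < b / 2 -> g (b / 2 - u) = g (b / 2 + u)) ->
    [/\ forall theta, 0 < theta ->
          ghat theta = expR (- b * theta) * ghat (- theta),
        forall lambda, 0 < lambda ->
          let a := alpha r lambda in
          fhat lambda = 1 - lambda / calA b r xR lambda *
            (sinh (a * b) - (expR (a * b) - 1) * ghat a) &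
        forall theta, Num.sqrt (2 * r) < theta ->
          let lambda := theta ^+ 2 / 2 - r in
          let s := sinh (theta * xR) + sinh (theta * (b - xR)) in
          ghat theta =
            ((lambda * sinh (theta * b) + r * s) * fhat lambda - r * s)
            / (lambda * (expR (theta * b) - 1))]).
Proof.
move=> fhat ghat.
have main lambda : 0 < lambda -> let a := alpha r lambda in
    fhat lambda = 1 - lambda / calA b r xR lambda *
      (sinh (a * b) - 1 / 2 * ((expR (a * b) - 1) * ghat a
                               + (1 - expR (- a * b)) * ghat (- a))).
  exact: (laplace_exit_density hr hxR heta hX hf hg).
split=> // gsym; have [densg _ _] := hg.
have ghat_sym theta : ghat theta = expR (- b * theta) * ghat (- theta).
  exact: (laplace_symmetric theta densg gsym).
have main_sym lambda : 0 < lambda -> let a := alpha r lambda in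
    fhat lambda = 1 - lambda / calA b r xR lambda *
      (sinh (a * b) - (expR (a * b) - 1) * ghat a).
  move=> lambda0 a; rewrite main// -/a; congr (1 - _ * (_ - _)).
  have -> : (1 - expR (- a * b)) * ghat (- a) = (expR (a * b) - 1) * ghat a.
    rewrite (ghat_sym a) mulrA; congr (_ * _).
    rewrite mulrBl mul1r -expRD.
    have -> : a * b + - b * a = 0 by ring.
    by rewrite expR0; congr (1 - expR _); ring.
  by field.
split=> // theta theta_gt lambda s.
have theta0 : 0 < theta by exact: le_lt_trans (sqrtr_ge0 _) theta_gt.
have lambda0 : 0 < lambda.
  rewrite subr_gt0 ltr_pdivlMr// mulrC -[X in X < _]sqr_sqrtr; last first.
    by rewrite mulr_ge0// ltW.
  by rewrite ltr_pXn2r// nnegrE ?sqrtr_ge0// ltW.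
have alphaE : alpha r lambda = theta.
  have lrE : 2 * (lambda + r) = theta ^+ 2 by rewrite /lambda; field.
  by rewrite /alpha lrE sqrtr_sqr gtr0_norm.
have /andP[xR0 xRb] := hxR.
have S0 : 0 < sinh (theta * b) by apply: sinh_gt0; exact: mulr_gt0.
have s0 : 0 < s.
  have S1 : 0 < sinh (theta * xR) by apply: sinh_gt0; exact: mulr_gt0.
  have S2 : 0 < sinh (theta * (b - xR)).
    by apply: sinh_gt0; rewrite mulr_gt0// subr_gt0.
  exact: addr_gt0 S1 S2.
have AE : calA b r xR lambda = lambda * sinh (theta * b) + r * s.
  by rewrite /calA alphaE /s; ring.
have A0 : lambda * sinh (theta * b) + r * s != 0.
  by rewrite gt_eqF// addr_gt0// mulr_gt0.
have E0 : expR (theta * b) - 1 != 0.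
  by rewrite gt_eqF// subr_gt0 expR_gt1 mulr_gt0.
have := main_sym lambda lambda0; rewrite alphaE AE => /= ->.
by field; rewrite A0 E0 gt_eqF.
Qed.
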